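(* Let $G$ be a finitely generated group that is hyperbolic relative to a collection $\mathbb{P}$ of subgroups of $G$, and let $H$ be an infinite index, infinite normal subgroup of $G$. Then $div(G,H)$ is linear.
   Context: Domination. For functions $f,g:[0,\infty)\to[0,\infty]$, $f\preceq g$ means there are $A,B,C>0$ with $f(x)\le g(Ax)+Bx$ for all $x>C$. For families indexed by $\rho\in(0,1]$ and integers $n\ge2$, $\{\sigma^n_\rho\}\preceq\{\sigma'^n_\rho\}$ means there are $L\in(0,1]$ and a positive integer $M$ with $\sigma^n_{L\rho}\preceq\sigma'^{Mn}_\rho$ for all $\rho,n$; $\sim$ means domination both ways. A single function is regarded as a constant family; a family is linear if it is $\sim$ to the function $r\mapsto r$. Lower relative divergence. For a finite generating set $S$ of $G$, work in the Cayley graph $X=\Gamma(G,S)$ with path metric $d_S$. Put $N_r(H)=\{x: d_S(x,H)<r\}$, $\partial N_r(H)=\{x:d_S(x,H)=r\}$, $C_r(H)=X-N_r(H)$, and let $d_r$ be the induced length metric on $C_r(H)$ ($\infty$ for points not joined by a path in $C_r(H)$). For $\rho\in(0,1]$ and integer $n\ge2$ let $\sigma^n_\rho(r)=\inf d_{\rho r}(x_1,x_2)$ over all $x_1,x_2\in\partial N_r(H)$ with $d_r(x_1,x_2)<\infty$ and $d_S(x_1,x_2)\ge nr$, with $\sigma^n_\rho(r)=\infty$ if there is no such pair. $div(G,H)$ is the family $\{\sigma^n_\rho\}$; up to $\sim$ it does not depend on $S$. Relative hyperbolicity. The coned-off Cayley graph $\hat\Gamma(G,S,\mathbb{P})$ is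 obtained from $\Gamma(G,S)$ by adding, for each left coset $gP$ with $P\in\mathbb{P}$, a vertex $v_{gP}$ and an edge of length $1/2$ from each $x\in gP$ to $v_{gP}$. $G$ is hyperbolic relative to $\mathbb{P}$ if $\hat\Gamma(G,S,\mathbb{P})$ is $\delta$-hyperbolic for some $\delta$ (every side of a geodesic triangle lies in the $\delta$-neighborhood of the union of the other two sides) and fine (for each $n$, every edge lies in only finitely many circuits of length $n$).
   Formalization: The formal theorem adds that G itself is not a member of the collection of peripheral subgroups; without this every finitely generated group is hyperbolic relative to {G}, and the claim fails for some central extensions of infinite small-cancellation groups. *)

(* Defs.v *)
From HB Require Import structures.
From mathcomp Require Import all_boot all_order all_algebra.
From mathcomp Require Import all_classical all_reals all_analysis.

Set Implicit Arguments.
Unset Strict Implicit.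
Unset Printing Implicit Defensive.

Import Order.TTheory GRing.Theory Num.Theory.

Local Open Scope classical_set_scope.
Local Open Scope ring_scope.

Section LengthMetric.
Variables (R : realType) (X : Type) (d : X -> X -> \bar R).

Definition dist_set (x : X) (A : set X) : \bar R := ereal_inf [set d x y | y in A].

Definition continuous_path (c : R -> X) : Prop :=
  forall t, 0 <= t <= 1 -> forall e : R, 0 < e ->
  exists2 h : R, 0 < h &
    forall s, 0 <= s <= 1 -> `|s - t| < h -> (d (c s) (c t) < e%:E)%E.

(* Here [s] lists the points of a subdivision of [0, 1], the first one (0)
   excluded, as in [variation]. *)
Definition subdivision_length (c : R -> X) (s : seq R) : \bar R :=
  let F := c \o nth 1 (0 :: s) in (\sum_(0 <= i < size s) d (F i) (F i.+1))%E.

Definition path_length (c : R -> X) : \bar R :=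
  ereal_sup [set subdivision_length c s | s in itv_partition 0 1].

Definition length_dist (A : set X) (x y : X) : \bar R :=
  ereal_inf [set path_length c | c in [set c : R -> X |
    [/\ continuous_path c, c 0 = x, c 1 = y &
        forall t, 0 <= t <= 1 -> A (c t)]]].

Definition geodesic_segment (x y : X) (A : set X) : Prop :=
  exists (l : R) (c : R -> X), [/\ 0 <= l, c 0 = x, c l = y,
    (forall s t, 0 <= s <= l -> 0 <= t <= l -> d (c s) (c t) = `|s - t|%:E) &
    A = c @` [set t | 0 <= t <= l]].

(* Only one side of the triangle is mentioned: the other two are obtained by
   permuting the vertices cyclically. *)
Definition delta_hyperbolic (delta : R) : Prop :=
  forall (x y z : X) (A B C : set X),
    geodesic_segment x y A -> geodesic_segment y z B ->
    geodesic_segment z x C ->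
    forall p, A p -> exists2 q, (B `|` C) q & (d p q <= delta%:E)%E.

Definition hyperbolic : Prop := exists delta : R, delta_hyperbolic delta.

End LengthMetric.

Record metric_graph (R : realType) := MetricGraph {
  vertex : Type;
  adj : vertex -> vertex -> Prop;
  edge_len : vertex -> vertex -> R;
  adj_sym : forall u v, adj u v -> adj v u;
  adj_irr : forall u, ~ adj u u;
  edge_len_sym : forall u v, edge_len u v = edge_len v u;
  edge_len_gt0 : forall u v, adj u v -> 0 < edge_len u v
}.

Section Realization.
Variables (R : realType) (X : metric_graph R).

(* Points of the geometric realization. An interior point of an edge has two
   representations, [Interior u v t] and [Interior v u (edge_len u v - t)];
   they are at distance 0 for [graph_dist]. *)
Inductive graph_point :=
| Vertex (v : vertex X)
| Interior (u v : vertex X) (t : R) of adj u v & 0 < t < edge_len u v.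

(* [p] is the point at distance [s] from [u] along the closed edge [u, v]. *)
Definition on_edge (u v : vertex X) (s : R) (p : graph_point) : Prop :=
  adj u v /\
  match p with
  | Vertex w => (w = u /\ s = 0) \/ (w = v /\ s = edge_len u v)
  | Interior u' v' t _ _ =>
      [/\ u' = u, v' = v & s = t] \/ [/\ u' = v, v' = u & s = edge_len u v - t]
  end.

(* [chain p q l]: one goes from [p] to [q] along finitely many straight
   segments, each contained in a closed edge, of total length [l]. *)
Inductive chain : graph_point -> graph_point -> R -> Prop :=
| Chain_nil p : chain p p 0
| Chain_cons u v s t p q r l :
    on_edge u v s p -> on_edge u v t q -> chain q r l ->
    chain p r (`|s - t| + l).

Definition graph_dist (p q : graph_point) : \bar R :=
  ereal_inf [set l%:E | l in chain p q].

(* An embedded closed path with [n] edges, as a cyclic sequence of vertices. *)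
Definition circuit (n : nat) (c : 'I_n -> vertex X) : Prop :=
  [/\ (2 < n)%N, injective c & forall i, adj (c i) (c (ordS i))].

(* Every circuit has 2n parametrizations, which does not affect finiteness. *)
Definition fine : Prop := forall (n : nat) (u v : vertex X), adj u v ->
  finite_set [set c : 'I_n -> vertex X | circuit c /\
    exists i, (c i = u /\ c (ordS i) = v) \/ (c i = v /\ c (ordS i) = u)].

End Realization.

Section Groups.
Variable G : groupType.
Implicit Types (S H A : set G) (P : set (set G)).

Definition subgroup A : Prop := group_closed [in A].

Definition normal_subgroup A : Prop :=
  subgroup A /\ forall g a, A a -> A (a ^ g)%g.

Definition generates S : Prop :=
  forall A, subgroup A -> S `<=` A -> A = [set: G].

Definition finite_generating_set S : Prop := finite_set S /\ generates S.

Definition finitely_generated : Prop := exists S, finite_generating_set S.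

Definition left_coset (g : G) A : set G := [set (g * a)%g | a in A].

Definition infinite_index A : Prop :=
  infinite_set [set left_coset g A | g in [set: G]].

Definition peripheral_cosets P : set (set G) :=
  [set B | exists2 A, P A & exists g, B = left_coset g A].

End Groups.

Section CayleyGraphs.
Variables (R : realType) (G : groupType) (S : set G) (P : set (set G)).

Definition cayley_adj (x y : G) : Prop :=
  x <> y /\ (S (x^-1 * y)%g \/ S (y^-1 * x)%g).

Lemma cayley_adj_sym x y : cayley_adj x y -> cayley_adj y x.
Proof. by case=> nxy; case=> Sxy; (split; [exact/nesym|]); [right|left]. Qed.

Lemma cayley_adj_irr x : ~ cayley_adj x x.
Proof. by case. Qed.

Definition cayley_graph : metric_graph R :=
  @MetricGraph R G cayley_adj (fun _ _ => 1) cayley_adj_sym cayley_adj_irr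
    (fun _ _ => erefl) (fun _ _ _ => ltr01).

Definition coned_vertex : Type := (G + peripheral_cosets P)%type.

Definition coned_adj (u v : coned_vertex) : Prop :=
  match u, v with
  | inl x, inl y => cayley_adj x y
  | inl x, inr B | inr B, inl x => (\val B : set G) x
  | inr _, inr _ => False
  end.

Definition coned_len (u v : coned_vertex) : R :=
  match u, v with inl _, inl _ => 1 | _, _ => 2^-1 end.

Lemma coned_adj_sym u v : coned_adj u v -> coned_adj v u.
Proof. by case: u v => [x|B] [y|C] //=; exact: cayley_adj_sym. Qed.

Lemma coned_adj_irr u : ~ coned_adj u u.
Proof. by case: u => [x|B] //=; exact: cayley_adj_irr. Qed.

Lemma coned_len_sym u v : coned_len u v = coned_len v u.
Proof. by case: u v => [x|B] [y|C]. Qed.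

Lemma coned_len_gt0 u v : coned_adj u v -> 0 < coned_len u v.
Proof. by case: u v => [x|B] [y|C] //= _; rewrite invr_gt0 ltr0n. Qed.

Definition coned_cayley_graph : metric_graph R :=
  @MetricGraph R coned_vertex coned_adj coned_len
    coned_adj_sym coned_adj_irr coned_len_sym coned_len_gt0.

End CayleyGraphs.

Definition relatively_hyperbolic (R : realType) (G : groupType)
    (P : set (set G)) : Prop :=
  exists2 S : set G, finite_generating_set S &
    hyperbolic (@graph_dist R (coned_cayley_graph R S P)) /\
    fine (coned_cayley_graph R S P).

(* [F rho n r] is meant for 0 < rho <= 1, n >= 2 and r >= 0 only, and takes
   values in [0, +oo]. *)
Definition function_family (R : realType) := R -> nat -> R -> \bar R.

Section Domination.
Variable R : realType.

Definition dominated (f g : R -> \bar R) : Prop :=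
  exists A B C : R, [/\ 0 < A, 0 < B, 0 < C &
    forall x, C < x -> (f x <= g (A * x)%R + (B * x)%:E)%E].

Definition family_dominated (F F' : function_family R) : Prop :=
  exists (L : R) (M : nat), [/\ 0 < L <= 1, (0 < M)%N &
    forall (rho : R) (n : nat), 0 < rho <= 1 -> (2 <= n)%N ->
      dominated (F (L * rho) n) (F' rho (M * n)%N)].

Definition family_equiv (F F' : function_family R) : Prop :=
  family_dominated F F' /\ family_dominated F' F.

Definition linear_family (F : function_family R) : Prop :=
  family_equiv F (fun _ _ r => r%:E).

End Domination.

Section LowerRelativeDivergence.
Variables (R : realType) (G : groupType) (S H : set G).

Let X := graph_point (cayley_graph R S).
Let d : X -> X -> \bar R := @graph_dist R (cayley_graph R S).
Let dH (x : X) : \bar R := dist_set d x [set @Vertex R (cayley_graph R S) h | h in H].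

Definition neighborhood (r : R) : set X := [set x | (dH x < r%:E)%E].
Definition neighborhood_boundary (r : R) : set X := [set x | dH x = r%:E].
Definition neighborhood_compl (r : R) : set X := ~` neighborhood r.
Definition dist_outside (r : R) : X -> X -> \bar R :=
  length_dist d (neighborhood_compl r).

Definition lower_relative_divergence : function_family R := fun rho n r =>
  ereal_inf [set e | exists x1 x2 : X,
    [/\ neighborhood_boundary r x1, neighborhood_boundary r x2,
        (dist_outside r x1 x2 < +oo)%E, ((n%:R * r)%:E <= d x1 x2)%E &
        e = dist_outside (rho * r) x1 x2]].

End LowerRelativeDivergence.

Arguments lower_relative_divergence R {G} S H rho n r.

(* Main.v *)
Require Import Defs.
From mathcomp Require Import all_boot all_order all_algebra.
From mathcomp Require Import all_classical all_reals all_analysis.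
From mathcomp Require Import zify lra.

Local Open Scope classical_set_scope.

(** The lower bound is immediate: a path between two points at distance at least
    [n * r] has length at least [n * r], and already nonnegativity is enough,
    because domination allows a linear summand.

    For the upper bound, it suffices that [H] contains an undistorted element [h],
    that is, the word length of [h ^+ k] grows linearly in [k]. Since [H] is
    normal, the distance to [H] is invariant under right multiplication by
    elements of [H], so that the path spelled by [h ^+ k] from a point [y] stays
    at almost constant distance from [H]. Starting from [y] at height [r] plus
    the length of [h], which exists because [H] has infinite index, and descending
    from both ends to height [r], one joins two points of the boundary which are at
    distance at least [n * r] by a path of linear length that never enters the
    neighborhood of radius [r] ([normal_divergence_linear]).

    The undistorted element comes from the length [cone_len] of the coned-off
    Cayley graph, which is at most a multiple of the word length. Three facts about
    it are needed.
    - It satisfies Gromov's four-point condition: this is the usual consequence of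
      thin triangles ([thin_four_point]).
    - It is acylindrical: few elements move little both of two distant points.
      Indeed, in a fine graph there are finitely many simple paths of bounded length
      between two vertices ([fine_finite_simple_paths], [cone_len_acylindrical]).
    - It is unbounded, because [G] is infinite and is not itself peripheral. In a
      bounded fine graph, an infinite peripheral subgroup, or infinitely many of
      them, would move a farthest vertex still farther ([cone_len_unbounded]).

    Assume that no element of [H] has powers of linearly growing length. By the
    four-point condition, the length of [h * h] then exceeds that of [h] by at most
    a constant, for all [h] in [H], and [H] satisfies up to a constant the
    ultrametric inequality of a group which fixes a point at infinity and preserves
    its horospheres ([len_mul_ultrametric]). Hence, if [k] is in [H], all elements
    of [H] which are not longer than [k] almost fix the midpoint of a geodesic from
    1 to [k] ([midpoint_almost_fixed]). Because [H] is normal, conjugation sends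
    these elements into the set [F] of elements of [H] of length at most a constant.
    So every finite subset of [H] injects into [F], while [F] is finite by
    acylindricity: its elements move little both 1 and the midpoint for a long [k].
    Thus [H] would be finite. If [H] has no long elements, then by normality its
    elements move all points by a bounded amount, and acylindricity applies to [H]
    itself ([normal_subgroup_undistorted]). *)

Set Implicit Arguments.
Unset Strict Implicit.
Unset Printing Implicit Defensive.

(** * Combinatorial distance in a graph *)

Section GraphDistance.

Definition least (A : set nat) : nat :=
  xget 0 [set n | A n /\ forall m, A m -> n <= m].

Lemma leastP A n : A n -> A (least A) /\ least A <= n.
Proof.
move=> An; have exA : exists n, `[< A n >] by exists n; apply/asboolP.
have : [set n | A n /\ forall m, A m -> n <= m] (least A).
  apply: xgetPex; case: (ex_minnP exA) => m /asboolP Am mmin.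
  by exists m; split=> // k Ak; apply: mmin; apply/asboolP.
by move=> [? h]; split=> //; exact: h.
Qed.

Lemma bounded_max (A : set nat) b n : A n -> (forall m, A m -> m <= b) ->
  exists2 m, A m & forall k, A k -> k <= m.
Proof.
move=> An leb; have exA : exists n, `[< A n >] by exists n; apply/asboolP.
have lebb m : `[< A m >] -> m <= b by move=> /asboolP; exact: leb.
case: (ex_maxnP exA lebb) => m /asboolP Am mmax.
by exists m => // k Ak; apply: mmax; apply/asboolP.
Qed.

Variables (T : choiceType) (E : T -> T -> Prop).

Definition walk (x y : T) (p : seq T) : Prop :=
  path [rel u v | `[< E u v >]] x p /\ last x p = y.

Definition gdist (x y : T) : nat := least [set size p | p in walk x y].

Lemma walk_nil x : walk x x [::]. Proof. by []. Qed.

Lemma walk_cons x y z p : E x y -> walk y z p -> walk x z (y :: p).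
Proof. by move=> Exy [pp lp]; split=> //=; rewrite pp andbT; apply/asboolP. Qed.

Lemma walk_edge x y : E x y -> walk x y [:: y].
Proof. by move=> Exy; exact: walk_cons (walk_nil y). Qed.

Lemma walk_cat x y z p q : walk x y p -> walk y z q -> walk x z (p ++ q).
Proof.
by move=> [pp lp] [pq lq]; split; rewrite ?cat_path ?last_cat ?lp ?pp.
Qed.

Lemma gdist_le x y p : walk x y p -> gdist x y <= size p.
Proof.
by move=> wp; have [] := @leastP [set size p | p in walk x y] (size p); [exists p|].
Qed.

Lemma gdist0 x : gdist x x = 0.
Proof. by apply/eqP; rewrite -leqn0; exact: gdist_le (walk_nil x). Qed.

Lemma gdist_edge x y : E x y -> gdist x y <= 1.
Proof. by move=> /walk_edge/gdist_le. Qed.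

Definition graph_connected := forall x y, exists p, walk x y p.

Hypothesis Esym : forall x y, E x y -> E y x.

Lemma walk_rev x y p : walk x y p ->
  exists2 q, walk y x q & size q = size p /\ {subset q <= x :: p}.
Proof.
move=> [pp lp]; exists (rev (belast x p)); last first.
  split; first by rewrite size_rev size_belast.
  by move=> z; rewrite mem_rev => /mem_belast.
split; last by rewrite -lp; case: p {pp lp} => //= a p; rewrite rev_cons last_rcons.
rewrite -lp rev_path; apply: sub_path pp => u v /= /asboolP Euv.
by apply/asboolP; exact: Esym.
Qed.

Hypothesis Econn : graph_connected.

Lemma gdistP x y : exists2 p, walk x y p & size p = gdist x y.
Proof.
have [p wp] := Econn x y.
have [|[q wq sq] _] := @leastP [set size p | p in walk x y] (size p); first by exists p.
by exists q.
Qed.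

Lemma gdist_triangle y x z : gdist x z <= gdist x y + gdist y z.
Proof.
have [p wp <-] := gdistP x y; have [q wq <-] := gdistP y z.
by rewrite -size_cat; apply: gdist_le; exact: walk_cat wp wq.
Qed.

Lemma gdist_sym x y : gdist x y = gdist y x.
Proof.
by apply/eqP; rewrite eqn_leq; apply/andP; split; [have [p] := gdistP y x|
  have [p] := gdistP x y] => /walk_rev[q wq [sq _]] <-; rewrite -sq; exact: gdist_le.
Qed.

Lemma gdist_eq0 x y : gdist x y = 0 -> x = y.
Proof. by move=> d0; have [p [_ lp]] := gdistP x y; rewrite d0 -lp => /size0nil ->. Qed.

Lemma walk_mem x y p z : walk x y p -> z \in x :: p ->
  gdist x z + gdist z y <= size p.
Proof.
move=> [pp lp] zp; case/splitPl: zp pp lp => p1 p2 lz.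
rewrite cat_path last_cat lz => /andP[pp1 pp2] lp2; rewrite size_cat.
by apply: leq_add; apply: gdist_le.
Qed.

Lemma gdist_between x y t : t <= gdist x y ->
  exists z, gdist x z = t /\ gdist z y = gdist x y - t.
Proof.
move=> let_; have [p [pp lp] sp] := gdistP x y.
have tsz : t <= size p by rewrite sp.
exists (last x (take t p)).
have [w1 w2] : walk x (last x (take t p)) (take t p) /\
               walk (last x (take t p)) y (drop t p).
  by move: pp lp; rewrite -{1 2}(cat_take_drop t p) cat_path last_cat => /andP[].
move: (gdist_le w1) (gdist_le w2) (gdist_triangle (last x (take t p)) x y).
by rewrite size_take size_drop; case: ltnP; lia.
Qed.

Lemma finite_ball x n : (forall u, finite_set [set v | E u v]) ->
  finite_set [set y | gdist x y <= n].
Proof.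
move=> fin; elim: n => [|n IH].
  apply: (@sub_finite_set _ _ [set x]); last exact: finite_set1.
  by move=> y; rewrite /= leqn0 => /eqP/gdist_eq0 <-.
apply: (@sub_finite_set _ _ ([set y | gdist x y <= n] `|`
   \bigcup_(u in [set y | gdist x y <= n]) [set v | E u v])).
  move=> y /=; rewrite leq_eqVlt ltnS => /orP[/eqP dy|]; last by left.
  right; have [|u [du duy]] := @gdist_between x y n; first by rewrite dy.
  exists u; first by rewrite /= du.
  have [p [pp lp] sp] := gdistP u y; move: sp pp lp; rewrite duy dy subSnn.
  by case: p => [|v []] //= _; rewrite andbT => /asboolP Euv <-.
by rewrite finite_setU; split=> //; apply: bigcup_finite.
Qed.

(** Discrete intermediate value theorem along a walk. *)
Lemma walk_crossing (f : T -> nat) x y p t :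
  (forall u v, E u v -> f v <= (f u).+1) -> walk x y p -> f x <= t < f y ->
  exists u v, [/\ u \in x :: p, v \in x :: p, E u v & f u = t].
Proof.
move=> flip [pp lp]; elim: p x pp lp => [x _ /= -> |a p IH x /= /andP[/asboolP Exa pp] lp] ht.
  by exfalso; lia.
case: (ltngtP (f x) t) => [ltt|?|eqt]; [|by exfalso; lia|].
  have [|u [v [up vp Euv ft]]] := IH a pp lp; first by have := flip _ _ Exa; lia.
  by exists u, v; split=> //; rewrite in_cons ?up ?vp orbT.
by exists x, a; split; rewrite // !inE eqxx ?orbT.
Qed.

End GraphDistance.

Lemma walk_map (T T' : choiceType) (E : T -> T -> Prop) (E' : T' -> T' -> Prop)
    (phi : T -> T') x y p :
  (forall u v, E u v -> E' (phi u) (phi v)) ->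
  walk E x y p -> walk E' (phi x) (phi y) (map phi p).
Proof.
move=> hphi; elim: p x => [x [_ /= ->]|a p IH x [/= /andP[/asboolP Exa pp] lp]] //.
by apply: walk_cons; [exact: hphi|exact: IH].
Qed.

Lemma gdist_lipschitz (T T' : choiceType) (E : T -> T -> Prop) (E' : T' -> T' -> Prop)
    (phi : T -> T') K :
  graph_connected E -> graph_connected E' ->
  (forall u v, E u v -> gdist E' (phi u) (phi v) <= K) ->
  forall x y, gdist E' (phi x) (phi y) <= K * gdist E x y.
Proof.
move=> cE cE' hphi x y; have [p [pp lp] <-] := gdistP cE x y.
elim: p x pp lp => [x _ /= ->|a p IH x /= /andP[/asboolP Exa pp] lp].
  by rewrite gdist0.
apply: leq_trans (gdist_triangle cE' (phi a) _ _) _.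
by rewrite mulnS leq_add ?hphi ?IH.
Qed.

(** * Simple paths in a fine graph *)

Section FineGraph.
Variables (T : choiceType) (E : T -> T -> Prop).

Definition closed_circuit (n : nat) (c : 'I_n -> T) : Prop :=
  [/\ 2 < n, injective c & forall i, E (c i) (c (ordS i))].

Definition simple_path (x y : T) (p : seq T) : Prop := walk E x y p /\ uniq (x :: p).

Lemma walk_simple x y p : walk E x y p ->
  exists2 q, simple_path x y q & {subset q <= p}.
Proof.
move=> [pp lp]; rewrite -lp; case/shortenP: pp => q pq uq sq.
by exists q.
Qed.

Lemma simple_path_size x y p q : simple_path x y q -> {subset q <= p} -> size q <= size p.
Proof. by move=> [_ /= /andP[_ uq]] sqp; apply: uniq_leq_size. Qed.

Hypothesis Esym : forall x y, E x y -> E y x.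
Hypothesis Efine : forall n u v, E u v ->
  finite_set [set c : 'I_n -> T | closed_circuit c /\
    exists i, (c i = u /\ c (ordS i) = v) \/ (c i = v /\ c (ordS i) = u)].

(** The path from [u] to [u0] closes up through [v] to a circuit which contains
    the edge [u0 -- v], and there are finitely many such circuits. *)
Lemma fine_finite_first_step v u0 N : E v u0 ->
  finite_set [set u | E v u /\ exists2 b, simple_path u u0 b & v \notin u :: b /\ size b <= N].
Proof.
move=> Evu0.
pose C n := [set c : 'I_n -> T | closed_circuit c /\
    exists i, (c i = u0 /\ c (ordS i) = v) \/ (c i = v /\ c (ordS i) = u0)].
apply: (@sub_finite_set _ _ ([set u0] `|` \bigcup_(n in `I_N.+3) \bigcup_(c in C n) range c)).
  move=> u [Evu [b [[pb lb] ub] [vb sb]]].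
  case: (posnP (size b)) => [/size0nil b0|b_gt0]; first by left; rewrite -lb b0.
  right; exists (size b).+2 => /=; first by lia.
  pose c (i : 'I_(size b).+2) := nth v (v :: u :: b) i.
  have uvb : uniq (v :: u :: b) by rewrite cons_uniq vb.
  exists c; last by exists (inord 1) => //; rewrite /c inordK.
  split; last first.
    exists ord_max; left; split; last by rewrite /c /= modnn.
    by rewrite /c /= -lb (last_nth v).
  split=> [|i j /eqP|i].
  - by lia.
  - by rewrite /c nth_uniq //= => /eqP/val_inj.
  - have := ltn_ord i; rewrite ltnS leq_eqVlt => /orP[/eqP iN|iN].
      rewrite /c /= iN modnn /=; apply: Esym.
      by move: Evu0; rewrite -lb (last_nth v).
    rewrite /c /= modn_small ?ltnS //.
    have pub : path [rel x y | `[< E x y >]] v (u :: b).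
      by rewrite /= pb andbT; apply/asboolP.
    by have /asboolP := pathP v pub i iN.
rewrite finite_setU; split; first exact: finite_set1.
apply: bigcup_finite => [|n _]; first exact: finite_II.
apply: bigcup_finite => [|c _]; first exact/Efine/Esym.
exact/finite_image/finite_finset.
Qed.

(** Given one simple path from [x] to [y], any other one goes from its first vertex
    [u] to [y] and back along the given path without meeting [x], so that [u] is
    one of finitely many vertices, and the rest is a shorter simple path. *)
Lemma fine_finite_simple_paths n x y :
  finite_set [set z | exists2 p, simple_path x y p & size p <= n /\ z \in x :: p].
Proof.
elim: n x => [|n IH] x.
  apply: (@sub_finite_set _ _ [set x]); last exact: finite_set1.
  by move=> z [p _ []]; rewrite leqn0 => /eqP/size0nil ->; rewrite inE => /eqP.
have [xy|xy] := eqVneq x y.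
  apply: (@sub_finite_set _ _ [set x]); last exact: finite_set1.
  move=> z [[_ [_]|a p [[_ lp] /andP[xp _]]]]; first by rewrite inE => /eqP.
  by move: xp; rewrite xy -lp [last _ _]/= mem_last.
have [[a0 sa0]|noa] := pselect (exists a, simple_path x y a); last first.
  apply: (@sub_finite_set _ _ set0); last exact: finite_set0.
  by move=> z [p sp _]; apply: noa; exists p.
case: a0 sa0 => [[[_ /= xy0]]|u0 a]; first by move: xy; rewrite xy0 eqxx.
move=> [[/= /andP[/asboolP Exu0 pa] la] /andP[xa ua]].
pose F := [set u | E x u /\ exists2 b, simple_path u u0 b &
                                  x \notin u :: b /\ size b <= n + size a].
apply: (@sub_finite_set _ _ ([set x] `|` \bigcup_(u in F)
   [set z | exists2 p, simple_path u y p & size p <= n /\ z \in u :: p])).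
  move=> z [[_ [_]|u b [[pb lb] ub] [sb]]]; first by rewrite inE => /eqP ->; left.
  rewrite inE => /orP[/eqP ->|zb]; first by left.
  right; move: pb lb ub => /= /andP[/asboolP Exu pb] lb /andP[xb ub].
  exists u; last by exists b.
  split=> //; have [q wq [sq subq]] := walk_rev Esym (conj pa la).
  have wbq : walk E u u0 (b ++ q) by apply: walk_cat wq.
  have [r sr subr] := walk_simple wbq; exists r => //.
  split; last first.
    have := simple_path_size sr subr; rewrite size_cat sq; move: sb => /=; lia.
  move: xb; rewrite !inE !negb_or => /andP[-> xb] /=; apply/negP => /subr.
  by rewrite mem_cat (negbTE xb) /= => /subq; exact/negP.
rewrite finite_setU; split; first exact: finite_set1.
by apply: bigcup_finite => [|u _]; [exact: fine_finite_first_step|exact: IH].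
Qed.

(** Removing the loops of a walk that does not return to [v] keeps its first edge, so
    that finiteness of simple paths bounds the number of first edges of walks. *)
Lemma fine_finite_exits n v w : finite_set [set u | E v u /\
  exists2 p, walk E u w p & v \notin u :: p /\ size p <= n].
Proof.
apply: sub_finite_set (fine_finite_simple_paths n.+1 v w).
move=> u [Evu [p wp [vp sp]]]; have [q sq subq] := walk_simple wp.
have sz := simple_path_size sq subq; case: sq => wq uq.
exists (u :: q); last by split; [exact: leq_ltn_trans sz _|rewrite !inE eqxx orbT].
split; first exact: walk_cons Evu wq.
rewrite cons_uniq uq andbT; apply: contra vp; rewrite !inE => /orP[->//|/subq->].
by rewrite orbT.
Qed.

End FineGraph.

(** * Normal subgroups of a group with a hyperbolic length function *)

Section HyperbolicLength.
Variables (G : groupType) (len : G -> nat) (D : nat).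
Local Open Scope group_scope.

Let d (x y : G) := len (x^-1 * y).

(* The generalization identifies lengths of convertible products whose group
   structures are inferred in different ways. *)
Local Ltac len_lia :=
  repeat (match goal with |- context [len ?x] => move: (len x) => ? end); lia.

Hypothesis len1 : len 1 = 0.
Hypothesis lenV : forall x, len x^-1 = len x.
Hypothesis lenM : forall x y, len (x * y) <= len x + len y.
Hypothesis four_point : forall x y z w,
  d x z + d y w <= maxn (d x y + d z w) (d x w + d y z) + D.

Let d_mull a x y : d (a * x) (a * y) = d x y.
Proof. by rewrite /d invgM mulgA -(mulgA x^-1) mulVg mulg1. Qed.

Let d1 x : d 1 x = len x. Proof. by rewrite /d invg1 mul1g. Qed.

Let d_sym x y : d x y = d y x.
Proof. by rewrite /d -lenV invgM invgK. Qed.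

Let d_mulr x h : d x (x * h) = len h.
Proof. by rewrite /d mulgA mulVg mul1g. Qed.

(** The four-point condition on [1, h ^+ n, h ^+ n.+1, h ^+ n.+2] propagates the
    gain of length from one power to the next. *)
Lemma hyperbolic_length_expg h : len h + D < len (h * h) ->
  forall k, k <= len (h ^+ k).
Proof.
move=> gain; have step k : len (h ^+ k) < len (h ^+ k.+1).
  elim: k => [|k IH]; first by rewrite expg0 len1 expg1; have := lenM h h; move: gain; len_lia.
  have := four_point 1 (h ^+ k) (h ^+ k.+1) (h ^+ k.+2).
  rewrite !d1 !(expgSr h) !d_mulr -(mulgA _ h h) d_mulr -!expgSr mulgA -!expgSr.
  by move: IH gain; len_lia.
by elim=> // k IH; exact: leq_ltn_trans IH (step k).
Qed.

Variable H : set G.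
Hypothesis HM : forall h k, H h -> H k -> H (h * k).
Hypothesis HV : forall h, H h -> H h^-1.
(** By [hyperbolic_length_expg], this is what remains when all elements of [H]
    have distorted powers. *)
Hypothesis no_gain : forall h, H h -> len (h * h) <= len h + D.

(** If the Gromov products of [h^-1] with [k] and of [k^-1] with [h] were both
    small, then [1, h, h * k, h * k * h, h * k * h * k] would be a local
    quasi-geodesic and [h * k] would gain length when squared. *)
Lemma len_mul_sum h k : H h -> H k ->
  len (h * k) + len (k * h) <= (2 * maxn (len h) (len k) + 3 * D)%N.
Proof.
move=> Hh Hk.
have p1 := four_point 1 h (h * k) (h * k * h).
have p2 := four_point h (h * k) (h * k * h) (h * k * h * k).
have p3 := four_point 1 (h * k) (h * k * h) (h * k * h * k).
have := no_gain (HM Hh Hk); rewrite mulgA; move: p1 p2 p3.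
have e1 : d h (h * k * h) = len (k * h) by rewrite -mulgA d_mulr.
have e2 : d (h * k) (h * k * h * k) = len (h * k) by rewrite -[X in d _ X]mulgA d_mulr.
have e3 : d h (h * k * h * k) = len (k * h * k) by rewrite -!mulgA d_mulr.
rewrite !d1 !d_mulr e1 e2 e3; len_lia.
Qed.

(** As [h] has small gain, it has the same direction as its inverse up to half its
    length, so that products with [h] and with [h^-1] are comparable. *)
Lemma len_mul_inv h k : H h ->
  len (h * k) <= maxn (len (h^-1 * k)) (len k + D) + D.
Proof.
move=> Hh; have := four_point h^-1 1 k h.
have := no_gain Hh; rewrite !d1 (d_sym k h).
rewrite /d invgK mulg1; len_lia.
Qed.

(** By [len_mul_inv], [h * k] and [k * h] have almost the same length if one of them
    is long, and [len_mul_sum] bounds their sum. In a horospherical group, a long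
    element goes up to its maximal height and back down, and a product does not
    go higher than its factors. *)
Lemma len_mul_ultrametric h k : H h -> H k ->
  len (h * k) <= (maxn (len h) (len k) + 3 * D)%N.
Proof.
move=> Hh Hk; have := len_mul_sum Hh Hk; have := len_mul_inv k Hh.
have := len_mul_inv h (HV Hk); rewrite invgK -[len (k^-1 * h)]lenV invgM invgK; len_lia.
Qed.

(** By the four-point condition, a point [y] at distance at most [m] from both [1]
    and [k] is at distance about [m - len k / 2] at most from the midpoint [x].
    Applied to [h * x], and again to [h^-1] and [h^-1 * k], it bounds the distance
    from [x] to [h * x] by the lengths of products of [h] and [k], which are at
    most that of [k] up to a constant by [len_mul_ultrametric]. *)
Lemma midpoint_almost_fixed k x : H k ->
  len x = (len k)./2 -> d x k = len k - (len k)./2 ->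
  forall h, H h -> len h <= len k -> len (x^-1 * h * x) <= (8 * D + 1)%N.
Proof.
move=> Hk lx dxk h Hh lehk.
have mid y : d x y + (len k)./2 <= maxn (d k y) (len y) + D.
  by have := four_point 1 x k y; rewrite !d1 dxk lx; len_lia.
have m1 := mid (h * x); have m2 := mid h^-1; have m3 := mid (h^-1 * k).
have hk := len_mul_ultrametric Hh Hk.
have hVk := len_mul_ultrametric (HV Hh) Hk.
have khk := len_mul_ultrametric (HV Hk) (HM Hh Hk).
have e1 : d k (h * x) = d x (h^-1 * k).
  by rewrite d_sym -(d_mull h^-1) mulgA mulVg mul1g.
have e2 : len (h * x) = d x h^-1 by rewrite d_sym /d invgK.
have e3 : d k h^-1 = len (h * k) by rewrite d_sym /d invgK.
have e4 : d k (h^-1 * k) = len (k^-1 * (h * k)).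
  by rewrite /d -lenV !invgM !invgK mulgA.
have e5 : len (x^-1 * h * x) = d x (h * x) by rewrite /d mulgA.
move: lehk m1 m2 m3 hk hVk khk; rewrite e1 e2 e3 e4 e5 !lenV; len_lia.
Qed.

End HyperbolicLength.

Section Undistorted.
Variables (G : groupType) (len : G -> nat) (D : nat).
Local Open Scope group_scope.

Hypothesis len1 : len 1 = 0.
Hypothesis lenV : forall x, len x^-1 = len x.
Hypothesis lenM : forall x y, len (x * y) <= len x + len y.
Hypothesis len_between : forall x t, t <= len x ->
  exists y, len y = t /\ len (y^-1 * x) = len x - t.
Hypothesis four_point : forall x y z w,
  len (x^-1 * z) + len (y^-1 * w) <=
  maxn (len (x^-1 * y) + len (z^-1 * w)) (len (x^-1 * w) + len (y^-1 * z)) + D.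
Hypothesis len_unbounded : forall n, exists x, n <= len x.
(** Acylindricity, for the points [1] and [x]. *)
Hypothesis len_acylindrical : forall e, exists n, forall x, n <= len x ->
  finite_set [set g | len g <= e /\ len (x^-1 * g * x) <= e].

(** Otherwise [H] would be finite, either because its elements have bounded length
    and hence move both of two distant points little, or because any finite part
    of [H] is conjugate into a fixed finite set. *)
Lemma normal_subgroup_undistorted (H : set G) :
  normal_subgroup H -> infinite_set H ->
  exists2 h, H h & forall k, k <= len (h ^+ k).
Proof.
move=> [[H1' HVM'] HJ] infH.
have H1 : H 1 by move: H1'; rewrite in_setE.
have HMV x y : H x -> H y -> H (x * y^-1).
  by move=> Hx Hy; have := HVM' x y; rewrite !in_setE; apply.
have HV x : H x -> H x^-1 by move=> Hx; rewrite -(mul1g x^-1); exact: HMV.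
have HM x y : H x -> H y -> H (x * y) by move=> Hx /HV; rewrite -{2}(invgK y); exact: HMV.
have HC x h : H h -> H (x^-1 * h * x) by move=> /(HJ x); rewrite conjgE ?mulgA.
apply: contrapT => nh.
have no_gain h : H h -> len (h * h) <= len h + D.
  move=> Hh; rewrite leqNgt; apply/negP => gain; apply: nh; exists h => //.
  exact: (hyperbolic_length_expg len1 lenM four_point).
have [[K HK]|unbH] := pselect (exists K, forall h, H h -> len h <= K).
  have [n acyl] := len_acylindrical K; have [x nx] := len_unbounded n.
  apply: infH; apply: sub_finite_set (acyl x nx) => h Hh.
  by split; apply: HK => //; exact: HC.
have far n : exists2 k, H k & n <= len k.
  apply: contrapT => nk; apply: unbH; exists n => h Hh; rewrite leqNgt.
  by apply/negP => /ltnW lt; apply: nk; exists h.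
have center k : H k -> exists2 x, len x = (len k)./2 &
    forall h, H h -> len h <= len k -> len (x^-1 * h * x) <= (8 * D + 1)%N.
  move=> Hk; have [|x [lx dx]] := @len_between k (len k)./2; first by lia.
  by exists x => //; exact: (midpoint_almost_fixed len1 lenV four_point HM HV no_gain).
set F := [set h | H h /\ len h <= (8 * D + 1)%N].
have finF : finite_set F.
  have [n acyl] := len_acylindrical ((8 * D + 1)%N).
  have [k Hk lk] := far (2 * n + (8 * D + 1))%N; have [x lx cx] := center k Hk.
  apply: (sub_finite_set _ (acyl x _)); last by lia.
  by move=> h [Hh lh]; split=> //; apply: cx => //; lia.
have /finite_seqP[s Fs] := finF.
have [B BH cB] := infinite_set_fset (size s).+1 infH.
have [m mB] : exists m, forall h, h \in finmap.enum_fset B -> len h <= m.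
  exists (\max_(h <- finmap.enum_fset B) len h) => h hB; exact: leq_bigmax_seq.
have [k Hk lk] := far m; have [x _ cx] := center k Hk.
have : size (map (fun h => x^-1 * h * x) (finmap.enum_fset B)) <= size s.
  apply: uniq_leq_size.
    rewrite map_inj_uniq ?finmap.fset_uniq // => h h' /mulIg/mulgI //.
  move=> _ /mapP[h hB ->]; have Hh : H h by exact: BH.
  have : F (x^-1 * h * x) by split; [exact: HC|apply: cx => //; exact: leq_trans (mB h hB) lk].
  by rewrite Fs.
by rewrite size_map => /(leq_trans cB); rewrite ltnn.
Qed.

End Undistorted.

(** * Subgroups and Cayley graphs *)

Section CayleyConnected.
Variable G : groupType.
Implicit Types (A S : set G).
Local Open Scope group_scope.

Lemma subgroup1 A : subgroup A -> A 1.
Proof. by case; rewrite in_setE. Qed.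

Lemma subgroupMV A x y : subgroup A -> A x -> A y -> A (x * y^-1).
Proof. by case=> _ h Ax Ay; have := h x y; rewrite !in_setE; apply. Qed.

Lemma subgroupV A x : subgroup A -> A x -> A x^-1.
Proof.
by move=> sA Ax; rewrite -(mul1g x^-1); apply: subgroupMV => //; exact: subgroup1.
Qed.

Lemma subgroupM A x y : subgroup A -> A x -> A y -> A (x * y).
Proof.
by move=> sA Ax Ay; rewrite -(invgK y); apply: subgroupMV => //; exact: subgroupV.
Qed.

Lemma cayley_adj_mull S a x y : cayley_adj S x y -> cayley_adj S (a * x) (a * y).
Proof.
by move=> [nxy Sxy]; split; [move=> /mulgI|rewrite !invgM -!mulgA !mulKg].
Qed.

(** The elements reachable from [1] form a subgroup which contains [S]. *)
Lemma cayley_connected S : generates S -> graph_connected (cayley_adj S).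
Proof.
move=> genS; pose A := [set g | exists p, walk (cayley_adj S) 1 g p].
have shift a x y : (exists p, walk (cayley_adj S) x y p) ->
    exists p, walk (cayley_adj S) (a * x) (a * y) p.
  move=> [p wp]; exists (map (fun u => a * u) p).
  by apply: (walk_map (phi := fun u => a * u)) wp => u v; exact: cayley_adj_mull.
have sA : subgroup A.
  split=> [|x y]; rewrite !in_setE /A /=; first by exists [::].
  move=> [p wp] [q wq]; have [q' wq' _] := walk_rev (@cayley_adj_sym _ S) wq.
  have [|r wr] := shift (x * y^-1) y 1; first by exists q'.
  by exists (p ++ r); apply: walk_cat wp _; move: wr; rewrite mulgVK mulg1.
have AT : A = setT.
  apply: genS => // s Ss; rewrite /A /=.
  have [->|s1] := eqVneq s 1; first by exists [::].
  exists [:: s]; apply: walk_edge; split; first by move/esym/eqP; exact/negP.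
  by left; rewrite invg1 mul1g.
have Ag g : A g by rewrite AT.
move=> x y; have [p wp] := shift x 1 (x^-1 * y) (Ag _).
by exists p; move: wp; rewrite mulg1 mulVKg.
Qed.

End CayleyConnected.

(** * The coned-off Cayley graph *)

Section ConedCayley.
Variables (G : groupType) (S : set G) (P : set (set G)).
Local Open Scope group_scope.

Hypothesis subP : forall A : set G, P A -> subgroup A.
Hypothesis finS : finite_set S.
Hypothesis genS : generates S.

Let V : choiceType := (G + peripheral_cosets P)%type.
Let E : V -> V -> Prop := @coned_adj G S P.
Let vtx (g : G) : V := inl g.

Lemma left_coset1 (B : set G) : left_coset 1 B = B.
Proof.
by apply/seteqP; split=> [_ [y By <-]|y By]; rewrite ?mul1g //; exists y; rewrite ?mul1g.
Qed.

Lemma left_coset_mul g h (B : set G) : left_coset g (left_coset h B) = left_coset (g * h) B.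
Proof.
apply/seteqP; split=> [_ [_ [y By <-] <-]|_ [y By <-]].
  by exists y; rewrite ?mulgA.
by exists (h * y); [exists y|rewrite mulgA].
Qed.

Lemma left_coset_peripheral g (B : set G) :
  peripheral_cosets P B -> peripheral_cosets P (left_coset g B).
Proof.
by move=> [A PA [h ->]]; exists A => //; exists (g * h); rewrite left_coset_mul.
Qed.

Definition coned_act (g : G) (u : coned_vertex P) : coned_vertex P :=
  match u with
  | inl x => inl (g * x)
  | inr B => inr (exist _ (left_coset g (\val B))
                    (mem_set (left_coset_peripheral g (set_valP B))))
  end.

Let act : G -> V -> V := coned_act.

Lemma coned_actM g h u : act g (act h u) = act (g * h) u.
Proof.
case: u => [x|B] /=; first by rewrite /act /= mulgA.
by congr inr; apply: val_inj => /=; rewrite left_coset_mul.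
Qed.

Lemma coned_act1 u : act 1 u = u.
Proof.
case: u => [x|B] /=; first by rewrite /act /= mul1g.
by congr inr; apply: val_inj => /=; rewrite left_coset1.
Qed.

Lemma coned_act_adj g u v : E u v -> E (act g u) (act g v).
Proof.
case: u v => [x|B] [y|C] //=; [exact: cayley_adj_mull| |].
all: by move=> Bx; eexists; eauto.
Qed.

Let Esym u v : E u v -> E v u. Proof. exact: coned_adj_sym. Qed.

Lemma peripheral_coset_inv (B : set G) x y : peripheral_cosets P B -> B x -> B y ->
  exists2 A, P A & A (x^-1 * y).
Proof.
move=> [A PA [g ->]] [a Aa <-] [b Ab <-]; exists A => //.
rewrite invgM -mulgA mulKg; apply: subgroupM (subP PA) _ Ab.
exact: subgroupV (subP PA) Aa.
Qed.

Lemma coned_connected : graph_connected E.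
Proof.
have conn x y : exists p, walk E (vtx x) (vtx y) p.
  have [p wp] := cayley_connected genS x y; exists (map vtx p).
  exact: (walk_map (phi := vtx)) wp.
have near u : exists x, exists p, walk E u (vtx x) p.
  case: u => [x|B]; first by exists x, [::].
  have [A PA [g Bg]] := set_valP B; exists g, [:: vtx g]; apply: walk_edge.
  by rewrite /E /= Bg; exists 1; rewrite ?mulg1 //; exact: subgroup1 (subP PA).
move=> u v; have [x [p wp]] := near u; have [y [q wq]] := near v.
have [r wr] := conn x y; have [q' wq' _] := walk_rev Esym wq.
by exists (p ++ (r ++ q')); apply: walk_cat wp (walk_cat wr wq').
Qed.

Let gdist_act g u v : gdist E (act g u) (act g v) = gdist E u v.
Proof.
have le h a b : gdist E (act h a) (act h b) <= gdist E a b.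
  have [p wp <-] := gdistP coned_connected a b.
  rewrite -(size_map (act h)); apply: gdist_le.
  by apply: walk_map wp => ? ?; exact: coned_act_adj.
apply/eqP; rewrite eqn_leq le /=.
by have := le g^-1 (act g u) (act g v); rewrite !coned_actM mulVg !coned_act1.
Qed.

(** The half-edges to the cone vertices make the metric of the coned-off graph
    integral on [G]: there it is the combinatorial distance for these steps, while
    [gdist E] counts every edge, including half-edges, as 1. *)
Definition cone_step (x y : G) : Prop :=
  cayley_adj S x y \/ exists2 B, peripheral_cosets P B & B x /\ B y.

Definition cone_len (g : G) : nat := gdist cone_step 1 g.

Lemma cone_step_sym x y : cone_step x y -> cone_step y x.
Proof.
by move=> [/cayley_adj_sym|[B PB []]]; [left|right; exists B].
Qed.

Lemma cone_connected : graph_connected cone_step.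
Proof.
move=> x y; have [p wp] := cayley_connected genS x y; exists p.
by rewrite -[p]map_id; apply: (walk_map (phi := id)) wp => u v; left.
Qed.

Lemma cone_step_mull a x y : cone_step x y -> cone_step (a * x) (a * y).
Proof.
move=> [/(cayley_adj_mull a)|[B PB [Bx By]]]; first by left.
right; exists (left_coset a B); first exact: left_coset_peripheral.
by split; [exists x|exists y].
Qed.

Lemma cone_distE x y : gdist cone_step x y = cone_len (x^-1 * y).
Proof.
have le a u v : gdist cone_step (a * u) (a * v) <= gdist cone_step u v.
  rewrite -[X in _ <= X]mul1n.
  apply: (gdist_lipschitz (phi := fun u => a * u) cone_connected cone_connected).
  by move=> ? ? /(cone_step_mull a)/gdist_edge.
apply/eqP; rewrite eqn_leq /cone_len -{1}[x]mulg1 -{1}[y](mulVKg x) le /=.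
by have := le x^-1 x y; rewrite mulVg.
Qed.

Lemma cone_len1 : cone_len 1 = 0. Proof. exact: gdist0. Qed.

Lemma cone_lenV x : cone_len x^-1 = cone_len x.
Proof.
by rewrite -[x^-1]mulg1 -cone_distE (gdist_sym cone_step_sym cone_connected).
Qed.

Lemma cone_lenM x y : cone_len (x * y) <= cone_len x + cone_len y.
Proof.
have := gdist_triangle cone_connected x 1 (x * y).
by rewrite (cone_distE x) mulKg.
Qed.

Lemma cone_len_between x t : t <= cone_len x ->
  exists y, cone_len y = t /\ cone_len (y^-1 * x) = cone_len x - t.
Proof.
by move=> /(gdist_between cone_connected)[y [dy dyx]]; exists y; rewrite -cone_distE.
Qed.

Lemma gdist_coned_le x y : gdist E (vtx x) (vtx y) <= (2 * cone_len (x^-1 * y))%N.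
Proof.
rewrite -cone_distE; apply: (gdist_lipschitz cone_connected coned_connected).
move=> u v [Euv|[B PB [Bu Bv]]]; first exact/leqW/(@gdist_edge _ E).
pose b : V := inr (exist _ B (mem_set PB)).
by apply: (@gdist_le _ E _ _ [:: b; vtx v]); apply: walk_cons (walk_edge _).
Qed.

(** Of two consecutive vertices at least one is a group element, so that a walk
    can be cut at its group elements into edges and passages through a cone. *)
Lemma gdist_coned_ge x y : cone_len (x^-1 * y) <= gdist E (vtx x) (vtx y).
Proof.
have [p [pp lp] <-] := gdistP coned_connected (vtx x) (vtx y); rewrite -cone_distE.
have [n] := ubnP (size p); elim: n x p pp lp => // n IH x [|[z|B] p] /=.
- by move=> _ [<-] _; rewrite gdist0.
- move=> /andP[/asboolP Exz pp] lp /(IH z p pp lp) le.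
  apply: leq_trans (gdist_triangle cone_connected z _ _) _.
  by rewrite -add1n leq_add // gdist_edge //; left.
- case: p => [|[z|C] p] //=; last by move=> /and3P[_ /asboolP].
  move=> /and3P[/asboolP Bx /asboolP Bz pp] lp lt.
  apply: leq_trans (gdist_triangle cone_connected z _ _) _.
  rewrite -add1n leq_add //; last by exact: leqW (IH z p pp lp (ltnW lt)).
  by apply: gdist_edge; right; exists (\val B) => //; exact: set_valP.
Qed.

Hypothesis Efine : forall n u v, E u v ->
  finite_set [set c : 'I_n -> V | closed_circuit E c /\
    exists i, (c i = u /\ c (ordS i) = v) \/ (c i = v /\ c (ordS i) = u)].

Let finite_group_vertices (Z : set V) : finite_set Z -> finite_set [set g | Z (vtx g)].
Proof. by apply: finite_preimage => x y _ _ []. Qed.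

(** If [g] moves [1] and [x] by at most [e], then concatenating paths from [1]
    to [g], from [g] to [g * x] and from [g * x] to [x] gives, once loops are
    removed, one of the finitely many simple paths of bounded length from [1] to
    [x]. Halfway, it can only follow the translate by [g] of a fixed path from
    [1] to [x]: a vertex there determines [g] up to finitely many choices. *)
Lemma cone_len_acylindrical e : exists n, forall x, n <= cone_len x ->
  finite_set [set g | cone_len g <= e /\ cone_len (x^-1 * g * x) <= e].
Proof.
exists (4 * e + 4)%N => x nx; have conn := coned_connected.
have [c [pc lc] _] := gdistP conn (vtx 1) (vtx x).
pose Z := [set z | exists2 p, simple_path E (vtx 1) (vtx x) p &
                              size p <= (4 * e + size c)%N /\ z \in vtx 1 :: p].
have finZ : finite_set Z by exact: fine_finite_simple_paths.
have finc : finite_set [set z | z \in vtx 1 :: c] by exact: finite_seq.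
apply: sub_finite_set (finite_image2 (fun a b => a * b^-1)
  (finite_group_vertices finZ) (finite_group_vertices finc)).
move=> g [lg lgx].
have [q1 wq1 sq1] := gdistP conn (vtx 1) (vtx g).
have [q3 wq3 sq3] := gdistP conn (vtx (g * x)) (vtx x).
have {}sq1 : size q1 <= (2 * e)%N.
  by rewrite sq1 (leq_trans (gdist_coned_le _ _)) // invg1 mul1g leq_mul2l.
have {}sq3 : size q3 <= (2 * e)%N.
  rewrite sq3 (leq_trans (gdist_coned_le _ _)) //.
  by rewrite leq_mul2l -cone_lenV invgM invgK mulgA lgx orbT.
have wq2 : walk E (vtx g) (vtx (g * x)) (map (act g) c).
  have := walk_map (fun u v => @coned_act_adj g u v) (conj pc lc).
  by rewrite /act /= mulg1.
have [r sr subr] := walk_simple (walk_cat wq1 (walk_cat wq2 wq3)).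
have szr := simple_path_size sr subr.
have far : (4 * e + 4)%N <= gdist E (vtx 1) (vtx x).
  by apply: leq_trans (gdist_coned_ge _ _); rewrite invg1 mul1g.
(* At height [2 * e + 2], an edge of the path is out of reach of both detours, of
   length at most [2 * e], and one of its ends is a group element. *)
have [||u [v [ur vr Euv du]]] := @walk_crossing _ _ (gdist E (vtx 1)) _ _ r ((2 * e + 2)%N) _ sr.1.
- move=> a b Eab; apply: leq_trans (gdist_triangle conn a _ _) _.
  by rewrite -addn1 leq_add2l gdist_edge.
- by rewrite gdist0; lia.
have [a [ar la]] : exists a, vtx a \in vtx 1 :: r /\
    (2 * e)%N < gdist E (vtx 1) (vtx a) < (2 * e + 4)%N.
  have [lu lv] : ((2 * e < gdist E (vtx 1) u < 2 * e + 4) /\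
                 (2 * e < gdist E (vtx 1) v < 2 * e + 4))%N.
    have := gdist_triangle conn u (vtx 1) v; have := gdist_triangle conn v (vtx 1) u.
    by have := gdist_edge Euv; have := gdist_edge (Esym Euv); lia.
  by case: u v Euv ur vr lu lv {du} => [a|B] [b|C] // *; [exists a|exists a|exists b].
have [b bc ab] : exists2 b, vtx b \in vtx 1 :: c & a = g * b.
  have in1 : vtx a \in vtx 1 :: q1 -> False.
    by move=> /(walk_mem wq1); lia.
  have in3 : vtx a \in vtx (g * x) :: q3 -> False.
    by move=> /(walk_mem wq3); have := gdist_triangle conn (vtx a) (vtx 1) (vtx x); lia.
  move: ar; rewrite inE => /orP[/eqP a1|/subr].
    by case: in1; rewrite a1 mem_head.
  rewrite !mem_cat => /or3P[a1|/mapP[[b|B] bc] // [->]|a3].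
  - by case: in1; rewrite inE a1 orbT.
  - by exists b => //; rewrite inE bc orbT.
  - by case: in3; rewrite inE a3 orbT.
exists a.
  exists r => //; split=> //; apply: leq_trans szr _.
  by rewrite !size_cat size_map; move: (size q1) (size q3) (size c) sq1 sq3 => *; lia.
by exists b => //; rewrite ab mulgK.
Qed.

Let coneP A (PA : P A) : peripheral_cosets P A.
Proof. by exists A => //; exists 1; rewrite left_coset1. Qed.

Let cone A (PA : P A) : V := inr (exist _ A (mem_set (coneP PA))).

Hypothesis properP : ~ P [set: G].

(** Let [w] be a translate of the cone vertex [v] of [A], as far from [v] as
    possible. For [p] in [A], a geodesic from [p w] to [w] is too short to pass
    through [v]. Preceded by a path from [v] to [p w] whose first edge depends
    on [p], it yields a path of bounded length from [v] to [w]. By fineness, there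
    are finitely many first edges. *)
Lemma bounded_peripheral_finite K A : (forall g, cone_len g <= K) ->
  P A -> finite_set A.
Proof.
move=> leK PA; have conn := coned_connected; have sA := subP PA; set v := cone PA.
have A1 := subgroup1 sA.
have vg g : A g -> act g v = v.
  move=> Ag; congr inr; apply: val_inj => /=; apply/seteqP; split=> [_ [y Ay <-]|y Ay].
    exact: subgroupM.
  by exists (g^-1 * y); rewrite ?mulVKg //; apply: subgroupM => //; exact: subgroupV.
have [m [g0 _ <-] max] : exists2 m, range (fun g => gdist E v (act g v)) m &
    forall k, range (fun g => gdist E v (act g v)) k -> k <= m.
  apply: (@bounded_max _ (2 * K + 2)%N (gdist E v (act 1 v))); first by exists 1.
  move=> _ [g _ <-].
  have d1 : gdist E v (vtx 1) <= 1 by apply: gdist_edge.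
  have d2 : gdist E (vtx g) (act g v) <= 1 by apply: gdist_edge; exists 1; rewrite ?mulg1.
  have d3 : gdist E (vtx 1) (vtx g) <= (2 * K)%N.
    by apply: leq_trans (gdist_coned_le _ _) _; rewrite leq_mul2l leK orbT.
  have := gdist_triangle conn (vtx 1) v (act g v).
  by have := gdist_triangle conn (vtx g) (vtx 1) (act g v); lia.
set w := act g0 v in max *.
have {}max g : gdist E v (act g v) <= gdist E v w by apply: max; exists g.
have vw : 0 < gdist E v w.
  have [g nAg] : exists g, ~ A g.
    apply: contrapT => nA; apply: properP; rewrite -[setT](_ : A = _) //.
    by apply/seteqP; split=> // g _; apply: contrapT => nAg; apply: nA; exists g.
  apply: leq_trans (max g); rewrite lt0n; apply/eqP => /(gdist_eq0 conn).
  move=> [] /(congr1 (fun B : set G => B g)) /= e; apply: nAg; rewrite e.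
  by exists 1; rewrite ?mulg1.
have [c wc sc] := gdistP conn v w.
case: c wc sc => [|[a|B] c] wc sc; first by move: vw; rewrite -sc.
  2: by case: wc => /= /andP[/asboolP].
have [/asboolP Aa wac] : `[< E v (vtx a) >] /\ walk E (vtx a) w c.
  by case: wc => /= /andP[].
have fin := fine_finite_exits Esym Efine (size c + gdist E v w) v w.
set Z := [set u | _] in fin.
apply: (@sub_finite_set _ _ ((fun p => p * a) @^-1` [set g | Z (vtx g)])); last first.
  by apply: finite_preimage (finite_group_vertices fin) => x y _ _ /mulIg.
move=> p Ap /=; split; first exact: subgroupM.
have [t wt st] := gdistP conn (act p w) w.
have le_t : gdist E (act p w) w <= gdist E v w.
  rewrite -(gdist_act g0^-1) /w !coned_actM mulVg coned_act1 gdist_sym //; exact: max.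
have dpw : gdist E v (act p w) = gdist E v w by rewrite -{1}(vg _ Ap) gdist_act.
exists (map (act p) c ++ t).
  apply: walk_cat wt; apply: (walk_map _ wac) => ? ?; exact: coned_act_adj.
split; last by rewrite size_cat size_map leq_add2l st.
apply/negP; rewrite inE mem_cat => /orP[//|/orP[/mapP[z zc vz]|vt]].
  have := walk_mem wac (z := z); rewrite inE zc orbT => /(_ isT).
  move: dpw; rewrite {1}vz gdist_act => ->.
  by move: sc => /=; lia.
have := walk_mem wt (z := v); rewrite inE vt orbT => /(_ isT).
by rewrite gdist_sym // dpw; lia.
Qed.

(** Let [g] be a group element as far from [1] as possible. For [p] in [A], a
    geodesic from [p * g] to [g] is too short to pass through [1], so that, with
    finitely many exceptions, there is a path of bounded length from [1] to [g]
    whose first edge leads to the cone vertex of [A]. Fineness leaves finitely many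
    such [A], and each of them is finite. *)
Lemma bounded_union_peripheral_finite K : (forall g, cone_len g <= K) ->
  finite_set (\bigcup_(A in P) A).
Proof.
move=> leK; have conn := coned_connected.
have [m [g _ <-] max] : exists2 m, range (fun g => gdist E (vtx 1) (vtx g)) m &
    forall k, range (fun g => gdist E (vtx 1) (vtx g)) k -> k <= m.
  apply: (@bounded_max _ (2 * K)%N (gdist E (vtx 1) (vtx 1))); first by exists 1.
  by move=> _ [h _ <-]; apply: leq_trans (gdist_coned_le _ _) _; rewrite leq_mul2l leK orbT.
have {}max h : gdist E (vtx 1) (vtx h) <= gdist E (vtx 1) (vtx g) by apply: max; exists h.
have [c wc sc] := gdistP conn (vtx 1) (vtx g).
have fin := fine_finite_exits Esym Efine (1 + (size c + gdist E (vtx 1) (vtx g)))%N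
  (vtx 1) (vtx g).
set Z := [set u | _] in fin.
have finZ : finite_set [set B : peripheral_cosets P | Z (inr B)].
  by apply: finite_preimage fin => ? ? _ _ [].
apply: (@sub_finite_set _ _ ([set g^-1] `|` ([set p | vtx p^-1 \in vtx 1 :: c] `|`
  \bigcup_(B in [set B | Z (inr B) /\ P (\val B)]) \val B))).
  move=> p [A PA Ap].
  have [pg|pg] := eqVneq (p * g) 1; first by left; rewrite -[p](mulgK g) pg mul1g.
  right; have [pc|pc] := boolP (vtx p^-1 \in vtx 1 :: c); [by left|right].
  exists (exist _ A (mem_set (coneP PA))) => //; split=> //.
  split; first exact: subgroup1 (subP PA).
  have [t wt st] := gdistP conn (vtx (p * g)) (vtx g).
  have le_t : gdist E (vtx (p * g)) (vtx g) <= gdist E (vtx 1) (vtx g).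
    rewrite -(gdist_act (p * g)^-1) /act /= mulVg; exact: max.
  exists (vtx p :: (map (act p) c ++ t)).
    apply: walk_cons => //; apply: walk_cat wt.
    have := walk_map (fun u v => @coned_act_adj p u v) wc.
    by rewrite /act /= mulg1.
  split; last by rewrite /= size_cat size_map ltnS leq_add2l st.
  apply/negP; rewrite inE => /orP[//|].
  have act1 z : act p z = vtx 1 -> z = vtx p^-1.
    by move=> e; rewrite -(coned_act1 z) -(mulVg p) -coned_actM e /act /= mulg1.
  rewrite inE => /orP[/eqP[p1]|].
    by case/negP: pc; rewrite -p1 invg1 mem_head.
  rewrite mem_cat => /orP[/mapP[z zc /esym/act1 zp]|tp].
    by case/negP: pc; rewrite -zp inE zc orbT.
  have := walk_mem wt (z := vtx 1); rewrite inE tp orbT => /(_ isT).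
  rewrite st => le; have d0 : gdist E (vtx (p * g)) (vtx 1) = 0 by lia.
  by have [/eqP] := gdist_eq0 conn d0; exact/negP.
rewrite !finite_setU; split; first exact: finite_set1.
split.
  apply: finite_preimage (finite_group_vertices (finite_seq (vtx 1 :: c))).
  by move=> ? ? _ _ /invg_inj.
apply: bigcup_finite; last by move=> B [_ PB]; exact: bounded_peripheral_finite leK PB.
by apply: sub_finite_set finZ => B [].
Qed.

(** If the length were bounded, finitely many elements would be adjacent to [1], and
    [G] would be a ball of a locally finite graph. *)
Lemma cone_len_unbounded : infinite_set [set: G] -> forall n, exists g, n <= cone_len g.
Proof.
move=> infG n; apply: contrapT => nn.
have leK g : cone_len g <= n by rewrite leqNgt; apply/negP => /ltnW lt; apply: nn; exists g.
have finU := bounded_union_peripheral_finite leK.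
pose U := S `|` [set s^-1 | s in S] `|` \bigcup_(A in P) A.
have fU : finite_set U by rewrite !finite_setU; split=> //; split=> //; exact: finite_image.
apply: infG; apply: (@sub_finite_set _ _ [set g | cone_len g <= n]).
  by move=> g _; exact: leK.
apply: (finite_ball cone_connected) => h.
apply: sub_finite_set (finite_image (fun u => h * u) fU) => g hg.
exists (h^-1 * g); last by rewrite mulVKg.
case: hg => [[_ [Sg|Sg]]|[B PB [Bh Bg]]].
- by left; left.
- by left; right; exists (g^-1 * h) => //; rewrite invgM invgK.
- by right; have [A PA AA] := peripheral_coset_inv PB Bh Bg; exists A.
Qed.

End ConedCayley.

(** * Paths in the geometric realization of a graph *)

Section Realization.
Import Order.TTheory GRing.Theory Num.Theory.
Local Open Scope ring_scope.
Variables (R : realType) (X : metric_graph R).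
Let d := @graph_dist R X.
Implicit Types (p q r : graph_point X) (a b l : R) (A : set (graph_point X)).

Lemma chain_ge0 p q l : chain p q l -> 0 <= l.
Proof. by elim=> // *; rewrite addr_ge0. Qed.

Lemma chain_cat p q r a b : chain p q a -> chain q r b -> chain p r (a + b).
Proof.
by elim=> [?|u v s t {}p {}q r' l ps qt _ IH] cb; rewrite ?add0r // -addrA; eauto using Chain_cons.
Qed.

Lemma chain_rev p q l : chain p q l -> chain q p l.
Proof.
elim=> [?|u v s t {}p {}q r {}l ps qt _ IH]; first exact: Chain_nil.
rewrite addrC -[X in _ + X]addr0 distrC; apply: chain_cat IH _.
by apply: Chain_cons qt ps _; exact: Chain_nil.
Qed.

Lemma graph_dist_le p q l : chain p q l -> (d p q <= l%:E)%E.
Proof. by move=> c; apply: ereal_inf_lbound; exists l. Qed.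

Lemma graph_dist_ge0 p q : (0 <= d p q)%E.
Proof. by apply: le_ereal_inf_tmp => _ [l /chain_ge0 l0 <-]; rewrite lee_fin. Qed.

Lemma graph_dist0 p : (d p p <= 0%:E)%E.
Proof. by apply: graph_dist_le; exact: Chain_nil. Qed.

Lemma graph_distC p q : d p q = d q p.
Proof. by congr ereal_inf; apply/seteqP; split=> _ [l /chain_rev c <-]; exists l. Qed.

Lemma graph_dist_triangle q p r a b :
  (d p q <= a%:E)%E -> (d q r <= b%:E)%E -> (d p r <= (a + b)%:E)%E.
Proof.
move=> pq qr; apply/lee_addgt0Pr => e e0.
have e2 : 0 < e / 2 by rewrite divr_gt0.
have [_ [l1 c1 <-]] : exists2 x, [set l%:E | l in chain p q] x & (x < (a + e / 2)%:E)%E.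
  by apply: ereal_inf_lt; apply: le_lt_trans pq _; rewrite lte_fin ltrDl.
rewrite lte_fin => lt1.
have [_ [l2 c2 <-]] : exists2 x, [set l%:E | l in chain q r] x & (x < (b + e / 2)%:E)%E.
  by apply: ereal_inf_lt; apply: le_lt_trans qr _; rewrite lte_fin ltrDl.
rewrite lte_fin => lt2.
apply: le_trans (graph_dist_le (chain_cat c1 c2)) _.
by rewrite -EFinD lee_fin; lra.
Qed.

(** At an interior point of an edge, take the smaller of the two largest values that
    the ends allow. All lower bounds for distances below come from such functions. *)
Lemma vertex_lipschitz_ext (f : vertex X -> R) :
  (forall u v, adj u v -> f u <= f v + edge_len u v) ->
  exists F : graph_point X -> R, (forall v, F (Vertex v) = f v) /\
    forall p q l, (d p q <= l%:E)%E -> F q <= F p + l.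
Proof.
move=> flip.
pose F p := match p with Vertex v => f v
  | Interior u v t _ _ => Num.min (f u + t) (f v + (edge_len u v - t)) end.
have FE u v s p : on_edge u v s p -> F p = Num.min (f u + s) (f v + (edge_len u v - s)).
  move=> [Auv]; have le1 := flip _ _ Auv; have le2 := flip _ _ (adj_sym Auv).
  rewrite (edge_len_sym v u) in le2.
  rewrite /F; case: p => [w [[-> ->]|[-> ->]]|u' v' t _ _ [[-> -> ->//]|[-> -> ->]]].
  - by rewrite subr0 addr0 min_l.
  - by rewrite subrr addr0 min_r.
  - by rewrite (edge_len_sym v u) minC subKr.
have cF p q l : chain p q l -> F q <= F p + l.
  elim=> [?|u v s t {}p {}q r {}l ps qt _ IH]; first by rewrite addr0.
  apply: le_trans IH _; rewrite addrA lerD2r (FE _ _ _ _ ps) (FE _ _ _ _ qt).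
  have := ler_norm (s - t); have := ler_norm (t - s); rewrite distrC => h1 h2.
  case: (leP (f u + s)) => _; rewrite ge_min; apply/orP; [left|right]; lra.
exists F; split=> // p q l dl; rewrite -lerBlDl -lee_fin; apply: le_trans dl; apply: le_ereal_inf_tmp => _ [l' c <-].
by rewrite lee_fin lerBlDl cF.
Qed.

(** Bounding the speed by 1, rather than fixing the length, makes these paths easy to
    concatenate and bounds how fast any Lipschitz function changes along them. *)
Definition lip_path A l p q : Prop := 0 <= l /\ exists c : R -> graph_point X,
  [/\ c 0 = p, c l = q,
      forall s t : R, 0 <= s <= l -> 0 <= t <= l -> (d (c s) (c t) <= `|s - t|%:E)%E &
      forall t : R, 0 <= t <= l -> A (c t)].

Lemma lip_path_nil A p : A p -> lip_path A 0 p p.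
Proof.
move=> Ap; split=> //; exists (fun=> p); split=> // s t _ _.
by apply: le_trans (graph_dist0 p) _; rewrite lee_fin.
Qed.

Lemma lip_path_sub A B l p q : A `<=` B -> lip_path A l p q -> lip_path B l p q.
Proof.
by move=> AB [l0 [c [c0 cl cd cA]]]; split=> //; exists c; split=> // t /cA /AB.
Qed.

Lemma lip_path_rev A l p q : lip_path A l p q -> lip_path A l q p.
Proof.
move=> [l0 [c [c0 cl cd cA]]]; split=> //; exists (fun t => c (l - t)).
split=> [||s t hs ht|t ht]; rewrite ?subr0 ?subrr //; last by apply: cA; lra.
apply: le_trans (cd _ _ _ _) _; [lra|lra|].
by rewrite lee_fin distrC (_ : l - t - (l - s) = s - t) //; lra.
Qed.

Lemma lip_path_cat A a b p q r :
  lip_path A a p q -> lip_path A b q r -> lip_path A (a + b) p r.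
Proof.
move=> [a0 [c [c0 ca cd cA]]] [b0 [e [e0 eb ed eA]]].
split; first exact: addr_ge0.
pose f t := if t <= a then c t else e (t - a).
have ordered (s t : R) : 0 <= s -> s <= t -> t <= a + b -> (d (f s) (f t) <= `|s - t|%:E)%E.
  move=> s0 st tab; rewrite /f; case: (leP t a) => ta; case: (leP s a) => sa.
  - by apply: cd; lra.
  - by exfalso; lra.
  - have h1 : (d (c s) (c a) <= `|s - a|%:E)%E by apply: cd; lra.
    have h2 : (d (c a) (e (t - a)%R) <= `|0 - (t - a)|%:E)%E.
      by rewrite ca -e0; apply: ed; lra.
    apply: le_trans (graph_dist_triangle h1 h2) _; rewrite lee_fin.
    by rewrite !ler0_norm; lra.
  - apply: le_trans (ed _ _ _ _) _; [lra|lra|].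
    by rewrite (_ : s - a - (t - a) = s - t) //; lra.
exists f; split=> [||s t hs ht|t ht].
- by rewrite /f a0.
- rewrite /f; case: leP => ab; last by rewrite addrC addKr.
  by have b00 : b = 0; [lra|rewrite b00 addr0 ca -e0 -eb b00].
- case: (leP s t) => st; first by apply: ordered; lra.
  by rewrite graph_distC distrC; apply: ordered; lra.
- by rewrite /f; case: leP => ta; [apply: cA|apply: eA]; lra.
Qed.

Lemma lip_path_tail A l q (c : R -> graph_point X) (r : R) :
  0 <= r <= l -> c l = q ->
  (forall s t : R, 0 <= s <= l -> 0 <= t <= l -> (d (c s) (c t) <= `|s - t|%:E)%E) ->
  (forall t : R, r <= t <= l -> A (c t)) -> lip_path A (l - r) (c r) q.
Proof.
move=> rl cl cd cA; split; first lra.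
exists (fun t => c (r + t)); split=> [||s t hs ht|t ht].
- by rewrite addr0.
- by rewrite addrC subrK.
- apply: le_trans (cd _ _ _ _) _; [lra|lra|].
  by rewrite (_ : r + s - (r + t) = s - t) //; lra.
- by apply: cA; lra.
Qed.

Lemma lip_path_edge u v : adj u v ->
  lip_path setT (edge_len u v) (Vertex u) (Vertex v).
Proof.
move=> Auv; have l0 := edge_len_gt0 Auv; split; first exact: ltW.
pose c t := if t == 0 then Vertex u else
  match pselect (0 < t < edge_len u v) with
  | left h => Interior Auv h | right _ => Vertex v end.
have con (t : R) : 0 <= t <= edge_len u v -> on_edge u v t (c t).
  move=> ht; split=> //; rewrite /c; case: eqP => [->|t0]; first by left.
  case: pselect => h; first by left.
  right; split=> //; apply/eqP; rewrite eq_le; apply/andP; split; first lra.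
  rewrite leNgt; apply/negP => tl; apply: h; rewrite tl andbT lt0r.
  by apply/andP; split; [exact/eqP|lra].
exists c; split=> //.
- by rewrite /c eqxx.
- by rewrite /c gt_eqF //; case: pselect => // h; exfalso; lra.
- move=> s t /con hs /con ht; apply: graph_dist_le.
  by rewrite -[X in chain _ _ X]addr0; exact: Chain_cons hs ht (Chain_nil _).
Qed.

(** Rescaled to [0, 1], the path is [l]-Lipschitz, and the lengths of its
    subdivisions are bounded by [l] times the variation of the identity. *)
Lemma length_dist_le A l p q : lip_path A l p q -> (length_dist d A p q <= l%:E)%E.
Proof.
move=> [l0 [c [c0 cl cd cA]]].
have itv (t : R) : 0 <= t <= 1 -> 0 <= l * t <= l.
  by move=> /andP[t0 t1]; rewrite mulr_ge0 //= ler_piMr.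
have cdl (s t : R) : 0 <= s <= 1 -> 0 <= t <= 1 ->
    (d (c (l * s)%R) (c (l * t)%R) <= (l * `|s - t|)%:E)%E.
  move=> hs ht; apply: le_trans (cd _ _ (itv _ hs) (itv _ ht)) _.
  by rewrite -mulrBr normrM ger0_norm.
have : [set path_length d c | c in [set c : R -> graph_point X |
    [/\ continuous_path d c, c 0 = p, c 1 = q &
        forall t : R, 0 <= t <= 1 -> A (c t)]]] (path_length d (fun t => c (l * t))).
  exists (fun t => c (l * t)) => //; split; rewrite ?mulr0 ?mulr1 //; last first.
    by move=> t ht; apply/cA/itv.
  move=> t ht e e0; exists (e / (l + 1)); first by rewrite divr_gt0 //; lra.
  move=> s hs; rewrite ltr_pdivlMr; last lra.
  move=> lt; apply: le_lt_trans (cdl s t hs ht) _; rewrite lte_fin.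
  by apply: le_lt_trans lt; rewrite mulrDr mulr1 mulrC lerDl.
move=> /ereal_inf_lbound/le_trans; apply.
apply: ge_ereal_sup => _ [s ps <-]; rewrite /subdivision_length.
have v1 := nondecreasing_variation (f := id) (fun _ _ _ _ h => h) ps.
rewrite -[l in X in (_ <= X)%E]mulr1 -[1 in X in (_ <= X)%E](subr0 1) -v1 /variation.
rewrite mulr_sumr -sumEFin !big_mkord; apply: lee_sum => i _ /=.
rewrite distrC; apply: cdl.
  by rewrite (itv_partition_nth_ge _ ps) ?(itv_partition_nth_le _ ps) // ltnS ltnW.
have lti : (i.+1 < (size s).+1)%N by rewrite ltnS.
by apply/andP; split; [exact: itv_partition_nth_ge lti ps|exact: itv_partition_nth_le lti ps].
Qed.

End Realization.

(** * Hyperbolicity of the coned-off Cayley graph *)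

Section ConedMetric.
Import Order.TTheory GRing.Theory Num.Theory.
Local Open Scope ring_scope.
Variables (R : realType) (G : groupType) (S : set G) (P : set (set G)).
Hypothesis genS : generates S.

Let X := coned_cayley_graph R S P.
Let d := @graph_dist R X.
Let vtx (g : G) : graph_point X := @Vertex R X (inl g).
Let dd (x y : G) : R := (cone_len S P (x^-1 * y)%g)%:R.

Lemma lip_path_cone_step x y : cone_step S P x y -> lip_path setT 1 (vtx x) (vtx y).
Proof.
move=> [xy|[B PB [Bx By]]]; first exact: (@lip_path_edge R X (inl x) (inl y)).
have -> : 1 = 2^-1 + 2^-1 :> R by lra.
pose b : vertex X := inr (exist _ B (mem_set PB)).
apply: (lip_path_cat (q := Vertex b)).
  exact: (@lip_path_edge R X (inl x) b).
exact: (@lip_path_edge R X b (inl y)).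
Qed.

Lemma lip_path_cone_walk x y p : walk (cone_step S P) x y p ->
  lip_path setT (size p)%:R (vtx x) (vtx y).
Proof.
elim: p x => [x [_ /= ->]|z p IH x [/= /andP[/asboolP xz pp] lp]]; first exact: lip_path_nil.
by rewrite -addn1 natrD addrC; apply: lip_path_cat (lip_path_cone_step xz) (IH z _).
Qed.

(** The distance to [x], extended to a cone vertex by a half plus the least distance
    to [x] in its coset, varies along each edge by at most its length. *)
Lemma coned_dist_ge x y l : (d (vtx x) (vtx y) <= l%:E)%E -> dd x y <= l.
Proof.
have conn := cone_connected P genS.
pose D g := gdist (cone_step S P) x g.
pose f (v : vertex X) : R := match v with
  | inl g => (D g)%:R
  | inr B => 2^-1 + (least [set D g | g in \val B])%:R end.
have [u v|F [Fv Fl]] := @vertex_lipschitz_ext R X f.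
  case: u v => [g|B] [h|C] //=.
  - move=> gh; rewrite -(natrD _ _ 1) ler_nat.
    have := gdist_triangle conn h x g; have : (gdist (cone_step S P) h g <= 1)%N.
      by apply: gdist_edge; left; exact: cayley_adj_sym.
    by rewrite /D; lia.
  - move=> Cg; have [|[h Ch <-] _] := @leastP [set D g | g in \val C] (D g); first by exists g.
    have : (D g <= D h + 1)%N.
      apply: leq_trans (gdist_triangle conn h x g) _; rewrite leq_add2l.
      by apply: gdist_edge; right; exists (\val C) => //; exact: set_valP.
    by rewrite -(ler_nat R) natrD; lra.
  - move=> Bh; have [|_] := @leastP [set D g | g in \val B] (D h); first by exists h.
    by rewrite -(ler_nat R); lra.
move=> /Fl; rewrite !Fv /f /D gdist0 add0r.
by rewrite cone_distE.
Qed.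

Lemma coned_distE x y : d (vtx x) (vtx y) = (dd x y)%:E.
Proof.
have [p wp sp] := gdistP (cone_connected P genS) x y.
have [_ [c [c0 cl cd _]]] := lip_path_cone_walk wp.
have le : (d (vtx x) (vtx y) <= (dd x y)%:E)%E.
  rewrite /dd -cone_distE // -sp -c0 -cl; apply: le_trans (cd _ _ _ _) _.
  - by rewrite lexx ler0n.
  - by rewrite lexx ler0n.
  - by rewrite sub0r normrN ger0_norm.
apply/eqP; rewrite eq_le le /=; move: le (graph_dist_ge0 (vtx x) (vtx y)) (@coned_dist_ge x y).
rewrite -/d; case: (d _ _) => [l _ _ h||] //=.
by rewrite lee_fin; apply: h.
Qed.

(** A path of speed at most 1 whose length is the distance of its ends is a geodesic. *)
Lemma coned_geodesic x y : exists A, geodesic_segment d (vtx x) (vtx y) A.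
Proof.
have [p wp sp] := gdistP (cone_connected P genS) x y.
have [l0 [c [c0 cl cd _]]] := lip_path_cone_walk wp.
set l := _%:R in l0 cl cd; have dl : d (c 0) (c l) = l%:E.
  by rewrite c0 cl coned_distE /dd -cone_distE // -sp.
exists (c @` [set t | 0 <= t <= l]); exists l, c; split=> //.
have ordered (s t : R) : 0 <= s -> s <= t -> t <= l -> d (c s) (c t) = `|s - t|%:E.
  move=> s0 st tl; apply/eqP; rewrite eq_le cd /=; [|lra|lra].
  have : (d (c s) (c t) <= `|s - t|%:E)%E by apply: cd; lra.
  have := graph_dist_ge0 (c s) (c t); rewrite -/d.
  case E: (d _ _) => [e||] //= _ _; rewrite lee_fin.
  have d1 : (d (c 0%R) (c s) <= `|0 - s|%:E)%E by apply: cd; lra.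
  have d2 : (d (c s) (c t) <= e%:E)%E by rewrite E.
  have d3 : (d (c t) (c l) <= `|t - l|%:E)%E by apply: cd; lra.
  have := graph_dist_triangle (graph_dist_triangle d1 d2) d3.
  by rewrite -/d dl lee_fin !ler0_norm; lra.
move=> s t hs ht; case: (leP s t) => st; first by apply: ordered; lra.
by rewrite /d graph_distC distrC; apply: ordered; lra.
Qed.

Lemma geodesic_point x y A p : geodesic_segment d (vtx x) (vtx y) A -> A p ->
  exists t, [/\ 0 <= t <= dd x y, (d (vtx x) p <= t%:E)%E &
                (d p (vtx y) <= (dd x y - t)%:E)%E].
Proof.
move=> [l [c [l0 c0 cl cd ->]]] [t ht <-].
have el : dd x y = l.
  have := cd 0 l; rewrite c0 cl coned_distE !lexx l0 => /(_ isT isT)[->].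
  by rewrite sub0r normrN ger0_norm.
exists t; split; first by rewrite el.
  rewrite -c0 cd //; last by rewrite lexx l0.
  by rewrite sub0r normrN ger0_norm //; case/andP: ht.
rewrite el -cl cd //; last by rewrite l0 lexx.
rewrite lee_fin distrC ger0_norm //.
by rewrite subr_ge0; case/andP: ht.
Qed.

Lemma geodesic_ends x y A : geodesic_segment d (vtx x) (vtx y) A -> A (vtx x) /\ A (vtx y).
Proof.
move=> [l [c [l0 c0 cl cd ->]]].
by split; [exists 0|exists l]; rewrite //= ?lexx ?l0.
Qed.

(** This compares the Gromov product of [x] and [y] at [w] with the distance from [w]
    to [q]; it is the sum of the triangle inequalities for [w, q, x] and [w, q, y]. *)
Lemma gromov_product_le x y w A q m : geodesic_segment d (vtx x) (vtx y) A -> A q ->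
  (d (vtx w) q <= m%:E)%E -> dd w x + dd w y - dd x y <= 2 * m.
Proof.
move=> gA Aq wq; have [t [ht xq qy]] := geodesic_point gA Aq.
rewrite /d graph_distC in xq.
have := coned_dist_ge (graph_dist_triangle wq xq).
by have := coned_dist_ge (graph_dist_triangle wq qy); lra.
Qed.

Variable delta : R.
Hypothesis delta_ge0 : 0 <= delta.
Hypothesis thin : delta_hyperbolic d delta.

(** In a thin triangle with vertices [x], [y], [w], the side from [x] to [y] has a
    point close to both other sides, because every point is close to one of them.
    Hence the previous inequality is almost an equality. *)
Lemma gromov_product_ge x y w A : geodesic_segment d (vtx x) (vtx y) A ->
  exists p m, [/\ A p, (d (vtx w) p <= m%:E)%E &
                  2 * m <= dd w x + dd w y - dd x y + 4 * delta + 2].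
Proof.
move=> gA; have [B gB] := coned_geodesic y w; have [C gC] := coned_geodesic w x.
have [l [c [l0 c0 cl cd eA]]] := gA.
pose n := cone_len S P (x^-1 * y)%g.
have el : n%:R = l.
  have := cd 0 l; rewrite c0 cl coned_distE !lexx l0 => /(_ isT isT)[].
  by rewrite /dd -/n sub0r normrN ger0_norm.
pose Q i := (i <= n)%N /\ exists2 q, C q & (d (c i%:R%R) q <= delta%:E)%E.
have Q0 : Q 0%N.
  split=> //; exists (vtx x); first by case: (geodesic_ends gC).
  by rewrite c0; apply: le_trans (graph_dist0 _) _; rewrite lee_fin.
have [i [lei [q Cq cq]] maxi] := bounded_max Q0 (fun m (Qm : Q m) => proj1 Qm).
have il : 0 <= (i%:R : R) <= l by rewrite ler0n -el ler_nat.
have [q' Bq' cq'] : exists2 q', B q' & (d (c i%:R%R) q' <= (1 + delta)%:E)%E.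
  move: lei; rewrite leq_eqVlt => /orP[/eqP ein|lti].
    exists (vtx y); first by case: (geodesic_ends gB).
    by rewrite ein el cl; apply: le_trans (graph_dist0 _) _; rewrite lee_fin addr_ge0.
  have i1l : 0 <= (i.+1%:R : R) <= l by rewrite ler0n -el ler_nat.
  have Ac : A (c i.+1%:R) by rewrite eA; exists i.+1%:R.
  have [q' [Bq'|Cq'] dq'] := thin gA gB gC Ac; last first.
    by exfalso; have := maxi i.+1; rewrite ltnn => h; suff: false by []; apply: h;
      split=> //; exists q'.
  exists q' => //; apply: graph_dist_triangle dq'.
  rewrite -/d cd // lee_fin -addn1 natrD opprD addrA subrr sub0r normrN normr1 //.
have Aci : A (c i%:R) by rewrite eA; exists i%:R.
have [s [hs wq qx]] := geodesic_point gC Cq.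
have [t [ht yq' q'w]] := geodesic_point gB Bq'.
have qc : (d q (c i%:R%R) <= delta%:E)%E by rewrite /d graph_distC.
have q'c : (d q' (c i%:R%R) <= (1 + delta)%:E)%E by rewrite /d graph_distC.
have wq' : (d (vtx w) q' <= (dd y w - t)%:E)%E by rewrite /d graph_distC.
have d1 := graph_dist_triangle wq qc; have d2 := graph_dist_triangle wq' q'c.
have xq : (d (vtx x) q <= (dd w x - s)%:E)%E by rewrite /d graph_distC.
have q'y : (d q' (vtx y) <= t%:E)%E by rewrite /d graph_distC.
have := coned_dist_ge (graph_dist_triangle (graph_dist_triangle xq qc)
                                           (graph_dist_triangle cq' q'y)).
have -> : dd w y = dd y w by rewrite /dd -cone_lenV // invgM invgK.
move=> le; case: (leP (s + delta) (dd y w - t + (1 + delta))) => cmp.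
  by exists (c i%:R), (s + delta); split=> //; lra.
by exists (c i%:R), (dd y w - t + (1 + delta)); split=> //; lra.
Qed.

(** A point of the side from [x] to [z] which almost realizes the Gromov product of
    [x] and [z] at [w] is close to one of the other sides of the triangle [x], [z],
    [y], and so bounds the Gromov product for that side. *)
Lemma thin_four_point x y z w :
  dd x z + dd y w <= Num.max (dd x y + dd z w) (dd x w + dd y z) + (6 * delta + 2).
Proof.
have ddC a b : dd a b = dd b a by rewrite /dd -cone_lenV // invgM invgK.
have [A gA] := coned_geodesic x z; have [B gB] := coned_geodesic z y.
have [C gC] := coned_geodesic y x.
have [p [m [Ap wp lem]]] := gromov_product_ge w gA.
have [q BCq pq] := thin gA gB gC Ap.
have wq := graph_dist_triangle wp pq.
rewrite (ddC y w) (ddC x w) (ddC z w) -lerBlDr le_max; apply/orP.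
case: BCq => [Bq|Cq].
  by right; have := gromov_product_le gB Bq wq; rewrite (ddC z y); lra.
by left; have := gromov_product_le gC Cq wq; rewrite (ddC y x); lra.
Qed.

End ConedMetric.

(** * Realization of the Cayley graph *)

Section CayleyRealization.
Import Order.TTheory GRing.Theory Num.Theory.
Local Open Scope ring_scope.
Variables (R : realType) (G : groupType) (S : set G).
Hypothesis genS : generates S.

Let X := cayley_graph R S.
Let d := @graph_dist R X.
Let vtx (g : G) : graph_point X := @Vertex R X g.
Let E := cayley_adj S.

Lemma lip_path_cayley_walk x y p : walk E x y p ->
  lip_path setT (size p)%:R (vtx x) (vtx y).
Proof.
elim: p x => [x [_ /= ->]|z p IH x [/= /andP[/asboolP xz pp] lp]]; first exact: lip_path_nil.
rewrite -addn1 natrD addrC; apply: lip_path_cat (IH z _) => //.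
exact: (@lip_path_edge R X x z).
Qed.

Lemma lip_path_cayley x y : lip_path setT (gdist E x y)%:R (vtx x) (vtx y).
Proof.
by have [p wp <-] := gdistP (cayley_connected genS) x y; exact: lip_path_cayley_walk.
Qed.

Lemma cayley_dist_ge x y l : (d (vtx x) (vtx y) <= l%:E)%E -> (gdist E x y)%:R <= l.
Proof.
have [u v uv|F [Fv Fl]] := @vertex_lipschitz_ext R X (fun g => (gdist E x g)%:R).
  rewrite /= -(natrD _ _ 1) ler_nat.
  apply: leq_trans (gdist_triangle (cayley_connected genS) v _ _) _.
  by rewrite leq_add2l; apply: gdist_edge; exact: cayley_adj_sym.
by move=> /Fl; rewrite !Fv gdist0 add0r.
Qed.

Lemma cayley_gdist_mull a x y : gdist E (a * x)%g (a * y)%g = gdist E x y.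
Proof.
have conn := cayley_connected genS.
have le b u v : (gdist E (b * u)%g (b * v)%g <= gdist E u v)%N.
  rewrite -[X in (_ <= X)%N]mul1n; apply: (gdist_lipschitz (phi := fun u => (b * u)%g) conn conn).
  by move=> ? ? /(cayley_adj_mull b)/gdist_edge.
apply/eqP; rewrite eqn_leq le /=.
by have := le a^-1%g (a * x)%g (a * y)%g; rewrite !mulKg.
Qed.

Lemma finite_cayley_ball n : finite_set S -> finite_set [set g | (gdist E 1%g g <= n)%N].
Proof.
move=> finS; apply: (finite_ball (cayley_connected genS)) => h.
apply: sub_finite_set (finite_image2 (fun h u => (h * u)%g) (finite_set1 h)
  (_ : finite_set (S `|` [set s^-1%g | s in S]))).
  move=> g [_ hg]; exists h => //; exists (h^-1 * g)%g; last by rewrite mulVKg.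
  by case: hg; [left|right; exists (g^-1 * h)%g; rewrite ?invgM ?invgK].
by rewrite finite_setU; split=> //; exact: finite_image.
Qed.

End CayleyRealization.

(** * Divergence of a normal subgroup with an undistorted element *)

Section NormalDivergence.
Import Order.TTheory GRing.Theory Num.Theory.
Local Open Scope ring_scope.
Variables (R : realType) (G : groupType) (S H : set G).
Hypothesis finS : finite_set S.
Hypothesis genS : generates S.
Hypothesis normH : normal_subgroup H.

Let X := cayley_graph R S.
Let d := @graph_dist R X.
Let vtx (g : G) : graph_point X := @Vertex R X g.
Let E := cayley_adj S.
Let conn : graph_connected E := cayley_connected genS.
Let Esym x y : E x y -> E y x. Proof. exact: cayley_adj_sym. Qed.
Let sH : subgroup H := proj1 normH.

Definition subgroup_dist (g : G) : nat := least [set gdist (cayley_adj S) h g | h in H].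

Let hd := subgroup_dist.

Lemma subgroup_distP g : exists2 a, H a & gdist E a g = hd g.
Proof.
have [|[a Ha da] _] := @leastP [set gdist E h g | h in H] (gdist E 1%g g).
  by exists 1%g => //; exact: subgroup1.
by exists a.
Qed.

Lemma subgroup_dist_le a g : H a -> (hd g <= gdist E a g)%N.
Proof. by move=> Ha; have [|] := @leastP [set gdist E h g | h in H] (gdist E a g); first by exists a. Qed.

Lemma subgroup_dist_lipschitz x y : (hd y <= hd x + gdist E x y)%N.
Proof.
have [a Ha <-] := subgroup_distP x.
exact: leq_trans (subgroup_dist_le y Ha) (gdist_triangle conn x _ _).
Qed.

Lemma subgroup_dist_mull a g : H a -> hd (a * g)%g = hd g.
Proof.
have le b x : H b -> (hd (b * x)%g <= hd x)%N.
  move=> Hb; have [c Hc <-] := subgroup_distP x.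
  rewrite -(cayley_gdist_mull genS b); apply: subgroup_dist_le; exact: subgroupM.
move=> Ha; apply/eqP; rewrite eqn_leq le //=.
by have := le a^-1%g (a * g)%g (subgroupV sH Ha); rewrite mulKg.
Qed.

(** The element [g * a] is the left translate of [g] by [g a g^-1], which is in [H]. *)
Lemma subgroup_dist_mulr a g : H a -> hd (g * a)%g = hd g.
Proof.
move=> Ha; have := proj2 normH g^-1%g a Ha; rewrite conjgE invgK mulgA => Hga.
by rewrite -(subgroup_dist_mull g Hga) mulgVK.
Qed.

(** If the distance to [H] did not exceed [m], each coset [g H = H g] would contain an
    element of length at most [m]. *)
Lemma subgroup_dist_onto : infinite_index H -> forall m, exists y, hd y = m.
Proof.
move=> infH m; apply: contrapT => nm.
have small y : (hd y < m)%N.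
  rewrite ltnNge; apply/negP => lem; have [a Ha day] := subgroup_distP y.
  have [|z [daz dzy]] := @gdist_between _ _ conn a y m; first by rewrite day.
  apply: nm; exists z; apply/eqP; rewrite eqn_leq.
  have := subgroup_dist_le z Ha; have := subgroup_dist_lipschitz z y.
  by rewrite dzy daz day; lia.
apply: infH; apply: sub_finite_set
  (finite_image (fun g => left_coset g H) (finite_cayley_ball genS m finS)).
move=> _ [g _ <-]; have [a Ha dag] := subgroup_distP g.
exists (a^-1 * g)%g.
  by rewrite /= -(cayley_gdist_mull genS a) mulg1 mulVKg dag ltnW.
have conj b : H b -> H (b ^ g)%g by exact: (proj2 normH).
have eqg b : (a^-1 * g * b = g * (a^-1 ^ g * b))%g by rewrite conjgE !mulgA mulgV mul1g.
apply/seteqP; split=> _ [b Hb <-].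
  rewrite eqg; exists (a^-1 ^ g * b)%g => //; apply: subgroupM => //.
  by apply: conj; exact: subgroupV.
exists ((a ^ g) * b)%g; first by apply: subgroupM => //; exact: conj.
by rewrite eqg [X in (g * X)%g]mulgA -conjMg mulVg conj1g mul1g.
Qed.

(** A 1-Lipschitz function which vanishes on [H] is a lower bound for the distance to
    [H]. This avoids computing that distance at the interior points of edges. *)
Lemma subgroup_height : exists F : graph_point X -> R,
  [/\ forall g, F (vtx g) = (hd g)%:R,
      forall p q l, (d p q <= l%:E)%E -> F q <= F p + l &
      forall p l, l <= F p -> (l%:E <= dist_set d p [set vtx h | h in H])%E].
Proof.
have [u v uv|F [Fv Fl]] := @vertex_lipschitz_ext R X (fun g => (hd g)%:R).
  rewrite /= -(natrD _ _ 1) ler_nat; apply: leq_trans (subgroup_dist_lipschitz v u) _.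
  by rewrite leq_add2l; apply: gdist_edge; exact: Esym.
exists F; split=> // p l lF; apply: le_ereal_inf_tmp => _ [_ [h Hh <-] <-].
apply: le_ereal_inf_tmp => _ [k c <-]; rewrite lee_fin.
have := Fl _ _ _ (graph_dist_le (chain_rev c)).
have -> : F (vtx h) = 0.
  by rewrite Fv; have := subgroup_dist_le h Hh; rewrite gdist0 leqn0 => /eqP ->.
by rewrite add0r; exact: le_trans.
Qed.

Let outside := @neighborhood_compl R G S H.

(** On a shortest path from [H] to [y], the distance to [H] is the parameter, so
    that this path leaves the neighborhood of radius [r] at time [r]. *)
Lemma lip_path_from_boundary y r : 0 <= r <= (hd y)%:R ->
  exists x, neighborhood_boundary H r x /\ lip_path (outside r) ((hd y)%:R - r) x (vtx y).
Proof.
move=> hr; have [F [Fv Fl FH]] := subgroup_height.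
have [a Ha da] := subgroup_distP y.
have [_ [c [c0 cl cd _]]] := lip_path_cayley R genS a y; rewrite -/E da in cl cd.
have Fc t : 0 <= t <= (hd y)%:R -> t <= F (c t).
  move=> ht; have := Fl _ _ _ (cd t (hd y)%:R ht _); rewrite ler0n lexx => /(_ isT).
  by rewrite cl Fv distrC ger0_norm; lra.
exists (c r); split.
  apply/eqP; rewrite eq_le FH ?Fc // andbT.
  apply: ereal_inf_le; exists (d (c r) (vtx a)); first by exists (vtx a) => //; exists a.
  rewrite /vtx -c0; apply: le_trans (cd _ _ hr _) _; first by rewrite lexx ler0n.
  by rewrite subr0 ger0_norm //; case/andP: hr.
apply: (lip_path_tail hr cl cd) => t ht; rewrite /outside /neighborhood_compl /neighborhood /=.
apply/negP; rewrite -leNgt; apply: FH.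
have t0 : 0 <= t <= (hd y)%:R by lra.
by have := Fc t t0; lra.
Qed.

(** By normality all the points [y * h ^+ j] are as far from [H] as [y], and between
    two consecutive ones this distance drops by at most the length of [h]. *)
Lemma lip_path_expg h y r k : H h -> r + (gdist E 1%g h)%:R <= (hd y)%:R ->
  lip_path (outside r) (k%:R * (gdist E 1%g h)%:R) (vtx y) (vtx (y * h ^+ k)%g).
Proof.
move=> Hh hr; have [F [Fv Fl FH]] := subgroup_height.
have FO p : r <= F p -> outside r p.
  by move=> /FH le; apply/negP; rewrite -leNgt.
elim: k => [|k IH].
  rewrite mul0r expg0 mulg1; apply/lip_path_nil/FO; rewrite Fv.
  by have := ler0n R (gdist E 1%g h); lra.
rewrite -natr1 mulrDl mul1r expgSr mulgA; apply: lip_path_cat IH _.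
set z := (y * h ^+ k)%g.
have hz : hd z = hd y.
  apply: subgroup_dist_mulr; elim: k {z} => [|k IH]; first exact: subgroup1.
  by rewrite expgSr; exact: subgroupM.
have dz : gdist E z (z * h)%g = gdist E 1%g h by have := cayley_gdist_mull genS z 1 h; rewrite mulg1.
have [l0 [c [c0 cl cd _]]] := lip_path_cayley R genS z (z * h)%g; rewrite -/E dz in l0 cl cd.
split=> //; exists c; split=> // t ht; apply: FO.
have := Fl _ _ _ (cd t 0 ht _); rewrite lexx l0 => /(_ isT).
rewrite c0 Fv hz subr0 ger0_norm; lra.
Qed.

Lemma lip_path_dist A l (p q : graph_point X) : lip_path A l p q -> (d p q <= l%:E)%E.
Proof.
move=> [l0 [c [<- <- cd _]]]; apply: le_trans (cd _ _ _ _) _; rewrite ?lexx ?l0 //.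
by rewrite sub0r normrN ger0_norm.
Qed.

Lemma divergence_ge0 rho n r : (0 <= lower_relative_divergence R S H rho n r)%E.
Proof.
apply: le_ereal_inf_tmp => _ [x1 [x2 [_ _ _ _ ->]]].
apply: le_ereal_inf_tmp => _ [c _ <-].
apply: (@le_trans _ _ (subdivision_length d c [:: 1])).
  by apply: sume_ge0 => i _; exact: graph_dist_ge0.
by apply: ereal_sup_ubound; exists [:: 1] => //; exact: itv_partition1.
Qed.

(** Go up from the boundary of the neighborhood of radius [r] to a point [y] which
    is slightly farther from [H], then to [y * h ^+ k] with [k] proportional to [r],
    which is equally far from [H], and down to the boundary again. *)
Lemma normal_divergence_linear h N :
  infinite_index H -> H h -> (forall k, (k <= N * gdist E 1%g (h ^+ k)%g)%N) ->
  linear_family (lower_relative_divergence R S H).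
Proof.
move=> indexH Hh undist.
have N0 : (0 < N)%N by have := undist 1%N; case: (N).
set w := gdist E 1%g h in undist *.
split; exists 1, 1%N; split; rewrite ?ltr01 ?lexx // => rho n hrho n2; last first.
  exists 1, 1, 1; split=> // x _; rewrite !mul1r mul1n -[leLHS]add0e.
  by apply: leeD => //; exact: divergence_ge0.
pose B : R := 2 * (w%:R + 1) + N%:R * (2 * n%:R + 2 * w%:R + 2) * w%:R + 1.
have w0 : 0 <= w%:R :> R by [].
have B0 : 0 < B.
  by rewrite /B ltr_wpDl // addr_ge0 // ?mulr_ge0 // ?addr_ge0 // mulr_ge0.
exists 1, B, 1; split=> // r r1; rewrite !mul1r.
have r0 : 0 <= r by lra.
pose M := (Num.truncn r).+1.
have rM : r < M%:R by have /andP[] := truncn_itv r0.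
have Mr : M%:R <= r + 1 by have /andP[] := truncn_itv r0; rewrite /M -natr1; lra.
have [y hy] := subgroup_dist_onto indexH (M + w)%N.
(* The term [2 * (w + 1)] compensates for both descents to the boundary. *)
pose k := (N * (n * M + 2 * (w + 1)))%N.
have Hk : H (h ^+ k)%g.
  by elim: (k) => [|j IH]; [exact: subgroup1|rewrite expgSr; exact: subgroupM].
have far : (n * M + 2 * (w + 1) <= gdist E y (y * h ^+ k)%g)%N.
  rewrite -{1}(mulg1 y) cayley_gdist_mull //.
  by have := undist k; rewrite /k leq_pmul2l.
have hyk : hd (y * h ^+ k)%g = (M + w)%N by rewrite subgroup_dist_mulr.
have [x1 [bx1 up]] : exists x, neighborhood_boundary H r x /\
    lip_path (outside r) ((M + w)%:R - r) x (vtx y).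
  by rewrite -hy; apply: lip_path_from_boundary; rewrite hy natrD; lra.
have [x2 [bx2 down]] : exists x, neighborhood_boundary H r x /\
    lip_path (outside r) ((M + w)%:R - r) x (vtx (y * h ^+ k)%g).
  by rewrite -hyk; apply: lip_path_from_boundary; rewrite hyk natrD; lra.
have across : lip_path (outside r) (k%:R * w%:R) (vtx y) (vtx (y * h ^+ k)%g).
  by apply: lip_path_expg => //; rewrite -/w hy natrD; lra.
have whole := lip_path_cat (lip_path_cat up across) (lip_path_rev down).
set L := _ + _ in whole.
have LB : L <= B * r.
  have kE : k%:R = N%:R * (n%:R * M%:R + 2 * (w%:R + 1)) :> R.
    by rewrite /k natrM natrD !natrM natrD.
  have n0 : 0 <= n%:R :> R by [].
  have N0' : 0 <= N%:R :> R by [].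
  rewrite /L kE natrD /B.
  have h1 : n%:R * M%:R + 2 * (w%:R + 1) <= (2 * n%:R + 2 * w%:R + 2) * r by nra.
  have h2 : N%:R * (n%:R * M%:R + 2 * (w%:R + 1)) * w%:R <=
            N%:R * ((2 * n%:R + 2 * w%:R + 2) * r) * w%:R.
    by rewrite ler_wpM2r // ler_wpM2l.
  have h3 : M%:R + w%:R - r <= (w%:R + 1) * r by nra.
  by nra.
apply: (@le_trans _ _ (length_dist d (outside (rho * r)) x1 x2)).
  apply: ereal_inf_lbound; exists x1, x2; split=> //.
  - exact: le_lt_trans (length_dist_le whole) (ltry _).
  - apply: le_ereal_inf_tmp => _ [l c <-]; rewrite lee_fin.
    have dl := graph_dist_le c; have d1 := lip_path_dist up.
    have d2 := lip_path_dist down; rewrite /d graph_distC in d1.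
    have := cayley_dist_ge genS (graph_dist_triangle (graph_dist_triangle d1 dl) d2).
    move: far; rewrite -(ler_nat R) natrD !natrM natrD -/E => far le.
    have : n%:R * r <= n%:R * M%:R by rewrite ler_wpM2l // ltW.
    by move: le; rewrite natrD; lra.
apply: (@le_trans _ _ (B * r)%:E); last first.
  by rewrite -[leLHS]add0e leeD // lee_fin.
apply: (@le_trans _ _ L%:E); last by rewrite lee_fin.
apply: length_dist_le; apply: lip_path_sub whole => p; apply: contra_not.
move=> /lt_le_trans; apply; rewrite lee_fin ler_piMl //; lra.
Qed.

End NormalDivergence.

(** * Undistorted elements of normal subgroups *)

Section RelativelyHyperbolic.
Import Order.TTheory GRing.Theory Num.Theory.
Variables (R : realType) (G : groupType) (S : set G) (P : set (set G)).
Hypothesis genS : generates S.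

Lemma cone_len_four_point :
  hyperbolic (@graph_dist R (coned_cayley_graph R S P)) ->
  exists D, forall x y z w : G, let d a b := cone_len S P (a^-1 * b)%g in
    d x z + d y w <= maxn (d x y + d z w) (d x w + d y z) + D.
Proof.
move=> [delta thin]; pose D := Num.bound (6 * `|delta| + 2)%R.
have thin' : delta_hyperbolic (@graph_dist R (coned_cayley_graph R S P)) `|delta|%R.
  move=> x y z A B C gA gB gC p Ap; have [q BCq pq] := thin x y z A B C gA gB gC p Ap.
  by exists q => //; apply: le_trans pq _; rewrite lee_fin ler_norm.
have DB : (6 * `|delta| + 2 <= D%:R)%R.
  by apply/ltW/archi_boundP; rewrite addr_ge0 ?mulr_ge0.
exists D => x y z w /=.
have := thin_four_point genS (normr_ge0 delta) thin' x y z w.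
rewrite -lerBlDr le_max -!natrD => /orP[] le.
- have : (cone_len S P (x^-1 * z) + cone_len S P (y^-1 * w) <=
          cone_len S P (x^-1 * y) + cone_len S P (z^-1 * w) + D)%N.
    by rewrite -(ler_nat R) [X in (_ <= X)%R]natrD; lra.
  by move=> /leq_trans; apply; rewrite leq_add2r leq_maxl.
- have : (cone_len S P (x^-1 * z) + cone_len S P (y^-1 * w) <=
          cone_len S P (x^-1 * w) + cone_len S P (y^-1 * z) + D)%N.
    by rewrite -(ler_nat R) [X in (_ <= X)%R]natrD; lra.
  by move=> /leq_trans; apply; rewrite leq_add2r leq_maxr.
Qed.

End RelativelyHyperbolic.

(** The two lengths may refer to different generating sets: [N] is the maximal
    coned-off length of the generators in [S]. *)
Lemma cone_len_le_gdist (G : groupType) (S0 S : set G) (P : set (set G)) :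
  generates S0 -> finite_generating_set S ->
  exists N, forall g, cone_len S0 P g <= N * gdist (cayley_adj S) 1%g g.
Proof.
move=> genS0 [finS genS]; have /finite_seqP[s Ss] := finS.
exists (\max_(u <- s) cone_len S0 P u) => g.
apply: (gdist_lipschitz (phi := id) (cayley_connected genS) (cone_connected P genS0)) => x y.
have le u : S u -> cone_len S0 P u <= \max_(v <- s) cone_len S0 P v.
  by rewrite Ss => us; exact: leq_bigmax_seq.
rewrite cone_distE // => -[_ [/le//|/le]].
by rewrite -cone_lenV // invgM invgK.
Qed.

Lemma relatively_hyperbolic_undistorted (R : realType) (G : groupType)
    (P : set (set G)) (H S : set G) :
  (forall A : set G, P A -> subgroup A) -> ~ P [set: G] ->
  relatively_hyperbolic R P -> normal_subgroup H -> infinite_set H ->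
  finite_generating_set S ->
  exists2 h, H h & exists N, forall k, k <= N * gdist (cayley_adj S) 1%g (h ^+ k)%g.
Proof.
move=> subP properP [S0 [finS0 genS0] [hyp fineS0]] normH infH fgS.
have [D four] := cone_len_four_point genS0 hyp.
have infG : infinite_set [set: G] by exact: sub_infinite_set infH.
have [h Hh hk] := normal_subgroup_undistorted (cone_len1 S0 P)
  (cone_lenV P genS0) (cone_lenM P genS0) (@cone_len_between _ _ P genS0) four
  (cone_len_unbounded subP finS0 genS0 fineS0 properP infG)
  (cone_len_acylindrical subP genS0 fineS0) normH infH.
exists h => //; have [N leN] := cone_len_le_gdist P genS0 fgS.
by exists N => k; exact: leq_trans (hk k) (leN _).
Qed.

Unset Implicit Arguments.

Theorem theorem8p25 (R : realType) (G : groupType) (P : set (set G)) (H : set G)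
    (fgG : finitely_generated G)
    (subP : forall A : set G, P A -> subgroup A)
    (properP : ~ P [set: G])
    (hypG : relatively_hyperbolic R P)
    (normH : normal_subgroup H)
    (infH : infinite_set H)
    (indexH : infinite_index H) :
  forall S : set G, finite_generating_set S ->
    linear_family (lower_relative_divergence R S H).
Proof.
move=> S fgS; have [finS genS] := fgS.
have [h Hh [N hk]] := relatively_hyperbolic_undistorted subP properP hypG normH infH fgS.
exact: (normal_divergence_linear R finS genS normH indexH Hh hk).
Qed.
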